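(* Let $s\in(0,1)$ and let $E\subset\mathbb{R}^n$ be a bounded convex set with nonempty interior and with $C^{1,\alpha}$ boundary, with $\alpha\in(s,1)$. Then there exists $C>0$, depending only on $n$ and on the ratio $\overline{\rho_E}/\underline{\rho_E}$, such that, for every $x\in\partial E$, $$H_s(x)\le C\,\big(\mathrm{diam}(E)\big)^{\frac{1-s}{2}}\left((1-s)\int_{\partial E}\frac{1-\nu(y)\cdot\nu(x)}{|x-y|^{n+s}}\,d\mu(y)\right)^{\frac12}.$$
   Context: For $x\in\partial E$, the fractional mean curvature of order $s$ at $x$ is $$H_s(x)=s(1-s)\lim_{\varepsilon\to0^+}\int_{\mathbb{R}^n\setminus B_\varepsilon(x)}\frac{\tilde\chi_E(y)}{|x-y|^{n+s}}\,dy,\qquad \tilde\chi_E=1\text{ on }E^c,\ \tilde\chi_E=-1\text{ on }E.$$ $\nu$ is the exterior unit normal to $\partial E$ and $d\mu$ the surface measure on $\partial E$. The inner and outer radii are $$\underline{\rho_E}:=\sup\{r>0:\exists\,x_o\in\mathbb{R}^n,\ B_r(x_o)\subset E\},\qquad \overline{\rho_E}:=\inf\{r>0:\exists\,x_o\in\mathbb{R}^n,\ B_r(x_o)\supset E\}.$$ *)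

(* Defs.v *)
From HB Require Import structures.
From mathcomp Require Import all_boot all_order all_algebra.
From mathcomp Require Import all_classical all_reals all_analysis.

Set Implicit Arguments.
Unset Strict Implicit.
Unset Printing Implicit Defensive.
Import Order.TTheory GRing.Theory Num.Theory.
Import numFieldTopology.Exports numFieldNormedType.Exports.

Local Open Scope classical_set_scope.
Local Open Scope ring_scope.

(* Caratheodory's construction: the infimum of the total gauge of the countable
   covers of A by admissible shapes.  [None] stands for an unused slot of the
   cover, so that finite and empty covers are allowed (this matters for gauges
   that never vanish, as in dimension 0). *)
Section cover_outer_measure.
Context {R : realType} {T I : Type}.
Variables (shape : I -> set T) (adm : set I) (gauge : I -> R).

Definition admissible_cover (A : set T) : set (nat -> option I) :=
  [set F | (forall k i, F k = Some i -> adm i) /\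
           A `<=` \bigcup_k oapp shape set0 (F k)].

Definition cover_measure (A : set T) : \bar R :=
  ereal_inf [set (\sum_(k <oo) (oapp gauge 0 (F k))%:E)%E
            | F in admissible_cover A].

Hypothesis gauge_ge0 : forall i, adm i -> 0 <= gauge i.

Let slot_ge0 A F : admissible_cover A F ->
  forall k, (0 <= (oapp gauge 0 (F k))%:E)%E.
Proof.
by move=> [admF _] k; rewrite lee_fin; case E : (F k) => [i|] //=;
  apply/gauge_ge0/(admF k).
Qed.

Lemma cover_measure_ge0 A : (0 <= cover_measure A)%E.
Proof.
apply: le_ereal_inf_tmp => _ [F AF <-].
by apply: nneseries_ge0 => k _ _; exact: slot_ge0 AF k.
Qed.

Lemma cover_measure0 : cover_measure set0 = 0%E.
Proof.
apply/eqP; rewrite eq_le cover_measure_ge0 andbT.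
apply: ereal_inf_lbound; exists (fun=> None); first by split.
by apply: eseries0.
Qed.

Lemma le_cover_measure : {homo cover_measure : A B / A `<=` B >-> (A <= B)%E}.
Proof.
move=> A B AB; apply/ereal_inf_le_tmp => _ [F [admF BF] <-].
by exists F => //; split => //; exact: subset_trans BF.
Qed.

Lemma cover_measure_sigma_subadditive : sigma_subadditive cover_measure.
Proof.
move=> A; have [[i ioo]|] := pselect (exists i, cover_measure (A i) = +oo%E).
  rewrite (eseries_pinfty _ _ ioo) ?leey// => k _.
  by rewrite -ltNye (lt_le_trans _ (cover_measure_ge0 _)).
rewrite -forallNE => Aoo.
suff add2e (e : {posnum R}) : (cover_measure (\bigcup_n A n) <=
    \sum_(i <oo) cover_measure (A i) + e%:num%:E)%E.
  by apply/lee_addgt0Pr => _/posnumP[].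
rewrite (le_trans _ (epsilon_trick _ _ _))//; last first.
  by move=> k; exact: cover_measure_ge0.
pose P n (F : nat -> option I) := admissible_cover (A n) F /\
  (\sum_(k <oo) (oapp gauge 0 (F k))%:E <=
     cover_measure (A n) + (e%:num / (2 ^ n.+1)%:R)%:E)%E.
have [G PG] : {G : nat -> nat -> option I & forall n, P n (G n)}.
  apply: (@choice _ _ P) => n; rewrite /P /cover_measure.
  set S := (X in ereal_inf X); move infS : (ereal_inf S) => iS.
  case: iS infS => [r Sr|Soo|Soo].
  - have en1 : (0 < e%:num / (2 ^ n.+1)%:R)%R by [].
    have /(lb_ereal_inf_adherent en1) : ereal_inf S \is a fin_num by rewrite Sr.
    move=> [x [F AF <- lex]].
    by exists F; split => //; rewrite -Sr; exact/ltW.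
  - by have := Aoo n; rewrite /cover_measure -/S Soo.
  - by have := cover_measure_ge0 (A n); rewrite /cover_measure -/S Soo.
pose h (p : nat * nat) : \bar R := (oapp gauge 0 (G p.1 p.2))%:E.
have h_ge0 p : (0 <= h p)%E by exact: slot_ge0 (PG p.1).1 p.2.
apply: (@le_trans _ _ (\esum_(i in setT) h i)%E).
  apply: ereal_inf_lbound => /=.
  have /card_esym/ppcard_eqP[f] := card_nat2.
  exists (fun k => G (f k).1 (f k).2).
    split=> [k i|t [i _] /(PG i).1.2 [j _ Gt]].
      exact: (PG (f k).1).1.1.
    by exists (f^-1%FUN (i, j)) => //=; rewrite invK ?inE.
  rewrite -(esum_pred_image h f xpredT) ?[fun=> _]set_true//.
  by rewrite image_eq.
rewrite (_ : esum _ _ = \sum_(i <oo) \sum_(j <oo) h (i, j))%E; last first.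
  pose J : nat -> set (nat * nat) := fun i => [set (i, j) | j in setT].
  rewrite (_ : setT = \bigcup_k J k); last first.
    by rewrite predeqE => -[a b]; split => // _; exists a => //; exists b.
  rewrite esum_bigcupT /=; last 2 first.
    - apply/trivIsetP => i j _ _ ij.
      rewrite predeqE => -[n m] /=; split => //= -[] [_] _ [<-{n} _].
      by move=> [m' _] [] /esym/eqP; rewrite (negbTE ij).
    - by move=> p; exact: h_ge0.
  rewrite -(image_id [set: nat]) -fun_true esum_pred_image//; last first.
    by move=> n _; exact: esum_ge0.
  apply: eq_eseriesr => /= j _.
  rewrite -(esum_pred_image h (pair j) predT)//=; last first.
    by move=> ? ? _ _; exact: (@can_inj _ _ _ snd).
  by congr esum; rewrite predeqE => -[a b]; split; move=> [i _ <-]; exists i.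
apply: lee_lim.
- by apply: is_cvg_nneseries => k *; apply: nneseries_ge0 => m *; exact: h_ge0.
- by apply: is_cvg_nneseries => k *; apply: adde_ge0 => //;
    exact: cover_measure_ge0.
- by near=> k; apply: lee_sum => i _; exact: (PG i).2.
Unshelve. all: by end_near. Qed.

End cover_outer_measure.

Definition caratheodory_measure {R : realType} {T : pointedType}
    (mu : {outer_measure set T -> \bar R}) :
    {measure set (caratheodory_type mu) -> \bar R} :=
  (mu : set (caratheodory_type mu) -> \bar R).

(* The norm of the library on 'rV[R]_d is the sup norm; it induces the usual
   topology (and bounded sets), but distances must be Euclidean. *)
Section euclidean.
Context {R : realType} {d : nat}.
Implicit Types (u v x : 'rV[R]_d) (E : set 'rV[R]_d).

Definition dot u v : R := \sum_i u 0 i * v 0 i.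
Definition enorm u : R := Num.sqrt (dot u u).
Definition eball x (r : R) : set 'rV[R]_d := [set y | enorm (x - y) < r].

Definition diam E : R := sup [set enorm (y - z) | y in E & z in E].
Definition frontier E : set 'rV[R]_d := closure E `\` interior E.

Definition inner_radius E : R :=
  sup [set r | 0 < r /\ exists x, eball x r `<=` E].
Definition outer_radius E : R :=
  inf [set r | 0 < r /\ exists x, E `<=` eball x r].

Lemma diam_ge0 E : 0 <= diam E.
Proof.
rewrite /diam; set S := [set _ | _ in _ & _ in _].
have [hS|/sup_out->//] := pselect (has_sup S).
have [[t St] _] := hS; have [y _ [z _ tE]] := St.
by apply: (@le_trans _ _ t); [rewrite -tE sqrtr_ge0 | exact: ub_le_sup hS.2 _ St].
Qed.

End euclidean.

Section lebesgue_Rd.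
Context (R : realType) (d : nat).
Implicit Types ab : 'rV[R]_d * 'rV[R]_d.

Definition box ab : set 'rV[R]_d :=
  [set x | forall i, ab.1 0 i <= x 0 i <= ab.2 0 i].
Definition box_adm : set ('rV[R]_d * 'rV[R]_d) :=
  [set ab : 'rV[R]_d * 'rV[R]_d | forall i, ab.1 0 i <= ab.2 0 i].
Definition box_volume ab : R := \prod_i (ab.2 0 i - ab.1 0 i).

Lemma box_volume_ge0 ab : box_adm ab -> 0 <= box_volume ab.
Proof. by move=> h; apply: prodr_ge0 => i _; rewrite subr_ge0. Qed.

Definition lebesgue_outer : set 'rV[R]_d -> \bar R :=
  cover_measure box box_adm box_volume.

HB.instance Definition _ := isOuterMeasure.Build R 'rV[R]_d lebesgue_outer
  (cover_measure0 box box_volume_ge0) (cover_measure_ge0 box box_volume_ge0)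
  (@le_cover_measure _ _ _ box box_adm box_volume)
  (cover_measure_sigma_subadditive box box_volume_ge0).

(* Lebesgue measure on R^d, defined on all Lebesgue-measurable sets. *)
Definition lebesgue_Rd := caratheodory_measure lebesgue_outer.

End lebesgue_Rd.

Section hausdorff.
Context (R : realType).

(* Volume pi^(m/2) / Gamma(m/2 + 1) of the unit ball of R^m. *)
Fixpoint unit_ball_volume (m : nat) : R :=
  match m with
  | 0 => 1
  | 1 => 2
  | m'.+2 => 2 * pi / m%:R * unit_ball_volume m'
  end.

Lemma unit_ball_volume_gt0 m : 0 < unit_ball_volume m.
Proof.
have [k] := ubnP m; elim: k m => // k IH [|[|m]] // /ltnSE mk.
rewrite /= mulr_gt0 ?IH ?(leq_trans _ mk)//.
by rewrite divr_gt0 ?mulr_gt0 ?pi_gt0.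
Qed.

Context (m d : nat).

Definition hausdorff_gauge (C : set 'rV[R]_d) : R :=
  unit_ball_volume m * (diam C / 2) ^+ m.
Definition small_diam (delta : R) : set (set 'rV[R]_d) :=
  [set C | forall x y, C x -> C y -> enorm (x - y) <= delta].

Lemma hausdorff_gauge_ge0 delta C : small_diam delta C -> 0 <= hausdorff_gauge C.
Proof.
move=> _; apply: mulr_ge0; first exact/ltW/unit_ball_volume_gt0.
by rewrite exprn_ge0// divr_ge0 ?diam_ge0.
Qed.

Definition hausdorff_pre (delta : R) : set 'rV[R]_d -> \bar R :=
  cover_measure id (small_diam delta) hausdorff_gauge.

Definition hausdorff_outer (A : set 'rV[R]_d) : \bar R :=
  ereal_sup [set hausdorff_pre delta A | delta in [set delta | 0 < delta]].

Let pre_ge0 delta A : (0 <= hausdorff_pre delta A)%E.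
Proof. exact/cover_measure_ge0/hausdorff_gauge_ge0. Qed.

Let pre_le delta A : 0 < delta -> (hausdorff_pre delta A <= hausdorff_outer A)%E.
Proof. by move=> d0; apply: ereal_sup_ubound; exists delta. Qed.

Lemma hausdorff_outer_ge0 A : (0 <= hausdorff_outer A)%E.
Proof. by apply: le_trans (pre_ge0 1 A) (pre_le _ _). Qed.

Lemma hausdorff_outer0 : hausdorff_outer set0 = 0%E.
Proof.
apply/eqP; rewrite eq_le hausdorff_outer_ge0 andbT.
apply: ge_ereal_sup => _ [delta _ <-].
by rewrite /hausdorff_pre cover_measure0//; exact: hausdorff_gauge_ge0.
Qed.

Lemma le_hausdorff_outer :
  {homo hausdorff_outer : A B / A `<=` B >-> (A <= B)%E}.
Proof.
move=> A B AB; apply: ge_ereal_sup => _ [delta d0 <-].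
by apply: le_trans (pre_le B d0); exact: le_cover_measure.
Qed.

Lemma hausdorff_outer_sigma_subadditive : sigma_subadditive hausdorff_outer.
Proof.
move=> A; apply: ge_ereal_sup => _ [delta d0 <-].
apply: le_trans (cover_measure_sigma_subadditive id
  (@hausdorff_gauge_ge0 delta) A) _.
by apply: lee_nneseries => [k _ _|k _]; [exact: pre_ge0 | exact: pre_le].
Qed.

HB.instance Definition _ := isOuterMeasure.Build R 'rV[R]_d hausdorff_outer
  hausdorff_outer0 hausdorff_outer_ge0 le_hausdorff_outer
  hausdorff_outer_sigma_subadditive.

(* m-dimensional Hausdorff measure in R^d, on its Caratheodory-measurable
   sets (which include the Borel sets); it is normalised so as to agree with
   the surface measure on m-dimensional C^1 submanifolds. *)
Definition hausdorff := caratheodory_measure hausdorff_outer.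

End hausdorff.

Section boundary.
Context {R : realType} {n : nat}.
Implicit Types (E : set 'rV[R]_n.+1) (x : 'rV[R]_n.+1) (Q : 'M[R]_n.+1).

Definition gradient (u : 'rV[R]_n -> R) (z : 'rV[R]_n) : 'rV[R]_n :=
  \row_i 'D_(delta_mx 0 i) u z.

(* Row vectors act on the left, so y *m Q are the coordinates of y in the
   orthonormal frame given by the columns of Q. *)
Definition base_coord Q x : 'rV[R]_n := col' ord_max (x *m Q).
Definition height_coord Q x : R := (x *m Q) 0 ord_max.

(* In the frame Q and within distance r of x, the interior of E is the strict
   subgraph of u and the frontier of E is the graph of u. *)
Definition graph_chart E x (r : R) Q (u : 'rV[R]_n -> R) : Prop :=
  [/\ 0 < r, Q *m Q^T = 1%:M &
    forall y, eball x r y ->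
      (interior E y <-> height_coord Q y < u (base_coord Q y)) /\
      (frontier E y <-> height_coord Q y = u (base_coord Q y))].

Definition C1_holder_on (D : set 'rV[R]_n) (alpha : R) (u : 'rV[R]_n -> R) :=
  (forall z, D z -> differentiable u z) /\
  exists K : R, forall z w, D z -> D w ->
    enorm (gradient u z - gradient u w) <= K * enorm (z - w) `^ alpha.

Definition C1_holder_boundary (alpha : R) E : Prop :=
  forall x, frontier E x -> exists r Q u,
    graph_chart E x r Q u /\ C1_holder_on (eball (base_coord Q x) r) alpha u.

(* The unit vector (- grad u, 1) / sqrt (1 + |grad u|^2), in the frame Q. *)
Definition graph_normal Q (u : 'rV[R]_n -> R) x : 'rV[R]_n.+1 :=
  let g := gradient u (base_coord Q x) in
  (Num.sqrt (1 + dot g g))^-1 *: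
    ((\row_j if unlift ord_max j is Some i then - g 0 i else 1) *m Q^T).

(* The value does not depend on the chart; E lies below the graph, hence the
   upward unit normal is the exterior one. *)
Definition exterior_normal E x : 'rV[R]_n.+1 :=
  xget 0 [set v | exists r Q u,
    [/\ graph_chart E x r Q u, differentiable u (base_coord Q x) &
        v = graph_normal Q u x]].

End boundary.

Section fractional_mean_curvature.
Context {R : realType} {d : nat}.

Definition signed_indicator (E : set 'rV[R]_d) (y : 'rV[R]_d) : R :=
  if y \in E then -1 else 1.

(* The limit is taken in the extended reals; it exists there for convex E, since
   the integrals are then monotone in eps (compare E with a supporting
   half-space at x). *)
Definition fractional_mean_curvature (s : R) (E : set 'rV[R]_d)
    (x : 'rV[R]_d) : \bar R :=
  ((s * (1 - s))%:E *
   lim ((fun eps : R =>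
     \int[lebesgue_Rd R d]_(y in ~` eball x eps)
        (signed_indicator E y / enorm (x - y) `^ (d%:R + s))%:E) @ 0^'+))%E.

End fractional_mean_curvature.

(* Main.v *)
(* Only the following is used of nu: nu(y) is a unit vector and E lies in the
   half-space {z | (z - y) . nu(y) <= 0}.  Put e = nu(x) and K(y) = |x-y|^-(d+s).
   Reflection at x maps the interior U of E into the complement of E, so that the
   integral defining the curvature is at most the integral of K over the
   complement W of U and of its image.  With
     tau_k = sup { -(y - x) . e | |x - y| < q_k, y outside U },  q_k = q_0 L^-k,
   the part of W at distance < q_k from x lies in a slab of thickness 2 tau_k;
   with u_k = tau_k / q_k the curvature is thus at most
   C s (1-s) (sum_k u_k q_k^-s + q_0^-s / s).
   On the other side (y - x) . nu(y) >= 0 >= (y - x) . e for y in the boundary,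
   whence 1 - nu(y) . e = |nu(y) - e|^2 / 2 >= ((y - x) . e)^2 / (2 |y - x|^2).
   At each scale q_k the boundary contains a set of measure >= c q_k^(d-1) at
   distance of order q_k from x and of depth >= tau_k / 2; these sets are disjoint
   for different k, and the boundary integral is at least c sum_k u_k^2 q_k^(-s-1).
   At the scale of the diameter it is also at least c q_0^(-s-1).  One concludes by
   the Cauchy-Schwarz inequality and sum_k q_k^(1-s) <= C q_0^(1-s) / (1-s).
   Hausdorff measures are bounded below through Lipschitz projections onto
   cubes, so that the area formula is never needed. *)
Require Import Defs.
From mathcomp Require Import all_boot all_order all_algebra.
From mathcomp Require Import all_classical all_reals all_analysis measurable_realfun.
From mathcomp Require Import ring lra.
Set Implicit Arguments.
Unset Strict Implicit.
Unset Printing Implicit Defensive.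
Import Order.TTheory GRing.Theory Num.Theory.
Import numFieldTopology.Exports numFieldNormedType.Exports.
Local Open Scope classical_set_scope.
Local Open Scope ring_scope.

(** The curvature is linear in the relative depths [u_k] while the boundary integral is quadratic in
    them: this mismatch is the origin of the square root. The weights [q_k^-s] and [q_k^(-s-1)] then
    dictate the second Cauchy-Schwarz factor, the sum of the [q_k^(1-s)], and with it the power of
    the diameter. The obstacle is that a supremum such as [tau_k] is witnessed by a single point,
    whereas the boundary integral needs a set of positive measure. Depth is measured on the whole
    complement because the slab estimate needs it there; on the other side, convexity supplies a
    half-space separating the deep point from [E], which keeps all boundary points on one side of it
    at least as deep. The constants must not depend on [s], although [s (1-s)] degenerates at both
    ends. The tail at infinity costs [1/s], absorbed by the prefactor; the geometric sum costs
    [1/(1-s)], but under the root, so that [1-s] outside leaves [sqrt (1-s)]. Stray powers [L^s]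
    with [L >= 1] are bounded by [L]. *)

(** * Euclidean scalar product and norm *)

Section dot_product.
Context {R : realType} {d : nat}.
Implicit Types (u v w x y z : 'rV[R]_d) (a r : R).

Lemma dotC u v : dot u v = dot v u.
Proof. by apply: eq_bigr => i _; rewrite mulrC. Qed.

Lemma dotDl u v w : dot (u + v) w = dot u w + dot v w.
Proof. by rewrite -big_split; apply: eq_bigr => i _; rewrite mxE mulrDl. Qed.

Lemma dotZl a u v : dot (a *: u) v = a * dot u v.
Proof. by rewrite /dot mulr_sumr; apply: eq_bigr => i _; rewrite mxE mulrA. Qed.

Lemma dotNl u v : dot (- u) v = - dot u v.
Proof. by rewrite -scaleN1r dotZl mulN1r. Qed.

Lemma dotBl u v w : dot (u - v) w = dot u w - dot v w.
Proof. by rewrite dotDl dotNl. Qed.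

Lemma dotDr u v w : dot u (v + w) = dot u v + dot u w.
Proof. by rewrite dotC dotDl !(dotC u). Qed.

Lemma dotZr a u v : dot u (a *: v) = a * dot u v.
Proof. by rewrite dotC dotZl dotC. Qed.

Lemma dotNr u v : dot u (- v) = - dot u v.
Proof. by rewrite dotC dotNl dotC. Qed.

Lemma dotBr u v w : dot u (v - w) = dot u v - dot u w.
Proof. by rewrite dotDr dotNr. Qed.

Lemma dot0l u : dot 0 u = 0.
Proof. by rewrite -(scale0r 0) dotZl mul0r. Qed.

Definition dotE := (dotDl, dotDr, dotBl, dotBr, dotZl, dotZr, dotNl, dotNr).

Lemma dot_ge0 u : 0 <= dot u u.
Proof. by apply: sumr_ge0 => i _; rewrite -expr2 sqr_ge0. Qed.

Lemma enorm_ge0 u : 0 <= enorm u. Proof. exact: sqrtr_ge0. Qed.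

Lemma enorm_sqr u : enorm u ^+ 2 = dot u u.
Proof. by rewrite sqr_sqrtr ?dot_ge0. Qed.

Lemma coord_le_enorm u i : `|u 0 i| <= enorm u.
Proof.
rewrite -(ler_pXn2r (ltn0Sn 1)) ?nnegrE ?enorm_ge0// enorm_sqr real_normK ?num_real//.
rewrite /dot (bigD1 i)//= -expr2 lerDl.
by apply: sumr_ge0 => j _; rewrite -expr2 sqr_ge0.
Qed.

Lemma enorm_eq0 u : enorm u = 0 -> u = 0.
Proof.
move=> u0; apply/rowP => i; rewrite mxE; apply/eqP.
by rewrite -normr_eq0 eq_le normr_ge0 andbT -u0 coord_le_enorm.
Qed.

Lemma enormZ a u : enorm (a *: u) = `|a| * enorm u.
Proof.
by rewrite /enorm dotZl dotZr mulrA -expr2 sqrtrM ?sqr_ge0// sqrtr_sqr.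
Qed.

Lemma enormN u : enorm (- u) = enorm u.
Proof. by rewrite /enorm dotNl dotNr opprK. Qed.

Lemma enormB u v : enorm (u - v) = enorm (v - u).
Proof. by rewrite -enormN opprB. Qed.

Lemma enorm0 : enorm (0 : 'rV[R]_d) = 0.
Proof. by rewrite /enorm dot0l sqrtr0. Qed.

(** Cauchy-Schwarz, by expanding the square of [enorm v *: u - enorm u *: v]. *)
Lemma dot_le_enorm u v : dot u v <= enorm u * enorm v.
Proof.
have [u0|u0] := eqVneq (enorm u) 0.
  by rewrite u0 (enorm_eq0 u0) dot0l mul0r.
have [v0|v0] := eqVneq (enorm v) 0.
  by rewrite v0 (enorm_eq0 v0) dotC dot0l mulr0.
have up : 0 < enorm u by rewrite lt_def u0 enorm_ge0.
have vp : 0 < enorm v by rewrite lt_def v0 enorm_ge0.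
have := dot_ge0 (enorm v *: u - enorm u *: v).
rewrite !dotE -!enorm_sqr (dotC v u) => h.
have uv := mulr_gt0 up vp.
rewrite -subr_ge0 -(pmulr_rge0 _ uv); nra.
Qed.

Lemma dot_le_unit u v : enorm v = 1 -> dot u v <= enorm u.
Proof. by move=> v1; have := dot_le_enorm u v; rewrite v1 mulr1. Qed.

Lemma norm_dot_le u v : `|dot u v| <= enorm u * enorm v.
Proof.
rewrite ler_norml dot_le_enorm andbT -[leRHS]opprK lerN2 -dotNl.
by rewrite -(enormN u) dot_le_enorm.
Qed.

Lemma enormD u v : enorm (u + v) <= enorm u + enorm v.
Proof.
rewrite -(ler_pXn2r (ltn0Sn 1)) ?nnegrE ?addr_ge0 ?enorm_ge0//.
rewrite sqrrD !enorm_sqr !dotE (dotC v u).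
by have := dot_le_enorm u v; lra.
Qed.

Lemma enorm_distD y x z : enorm (x - z) <= enorm (x - y) + enorm (y - z).
Proof. by rewrite -[X in enorm X](subrKA y) enormD. Qed.

Lemma enorm_dist_le u v : enorm u - enorm v <= enorm (u - v).
Proof. by rewrite lerBlDr -{1}(subrK v u) enormD. Qed.

Lemma enorm_le_sum u : enorm u <= \sum_i `|u 0 i|.
Proof.
have s0 : 0 <= \sum_i `|u 0 i| by exact: sumr_ge0.
rewrite -(ler_pXn2r (ltn0Sn 1)) ?nnegrE ?enorm_ge0// enorm_sqr.
rewrite expr2 mulr_sumr; apply: ler_sum => i _.
rewrite -expr2 -real_normK ?num_real// expr2 ler_wpM2r//.
by rewrite (bigD1 i)//= lerDl sumr_ge0.
Qed.

Lemma enorm_le_coord u r : (forall i, `|u 0 i| <= r) -> enorm u <= d%:R * r.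
Proof.
move=> ur; apply: le_trans (enorm_le_sum u) _.
apply: le_trans (ler_sum _ (fun i _ => ur i)) _.
by rewrite sumr_const card_ord mulr_natl.
Qed.

Lemma eball_center x r : 0 < r -> eball x r x.
Proof. by rewrite /eball/= subrr enorm0. Qed.

End dot_product.

(** * Topology in terms of Euclidean balls *)

Section euclidean_topology.
Context {R : realType} {n : nat}.
Local Notation d := n.+1.
Implicit Types (u v w x y z : 'rV[R]_d) (a r : R) (A E : set 'rV[R]_d).

Lemma nbhs_eball x A : nbhs x A <-> exists2 r, 0 < r & eball x r `<=` A.
Proof.
split.
  move=> /nbhs_ballP[r/= r0 rA]; exists r => // y xy; apply: rA.
  rewrite mx_norm_ball /ball_/= [`|_|]mx_normrE bigmax_lt// => -[i j] _ /=.
  by apply: le_lt_trans xy; rewrite (ord1 i); exact: coord_le_enorm.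
(* The Euclidean norm is at most [d] times the sup norm; the extra factor 1/2 makes the inequality
   strict. *)
move=> [r r0 rA]; apply/nbhs_ballP; exists (r / d%:R / 2) => /=.
  by rewrite !divr_gt0.
move=> y; rewrite mx_norm_ball /ball_/= => xy; apply: rA.
rewrite /eball/=.
have /le_lt_trans : enorm (x - y) <= d%:R * (r / d%:R / 2).
  apply: enorm_le_coord => i; apply: le_trans (ltW xy).
  by have := @le_bigmax _ _ _ 0 (fun ij => `|(x - y) ij.1 ij.2|) (0, i); rewrite -mx_normrE.
apply; rewrite mulrA (mulrC r) mulrA mulfV ?pnatr_eq0//.
lra.
Qed.

Lemma eball_open x r : open (eball x r).
Proof.
rewrite openE => y xy; apply/nbhs_eball; exists (r - enorm (x - y)).
  by rewrite subr_gt0.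
move=> z yz; rewrite /eball/=; apply: le_lt_trans (enorm_distD y x z) _.
by move: yz; rewrite /eball/=; lra.
Qed.

Lemma interior_eball x A : (interior A) x <-> exists2 r, 0 < r & eball x r `<=` A.
Proof. exact: nbhs_eball. Qed.

Lemma eball_interior x r A : eball x r `<=` A -> eball x r `<=` interior A.
Proof. by move=> xA; rewrite -open_subsetE//; exact: eball_open. Qed.

Lemma closure_eball x A :
  closure A x <-> forall r, 0 < r -> exists2 y, A y & enorm (x - y) < r.
Proof.
split=> [Ax r r0|xA B /nbhs_eball[r r0 rB]].
  by have [|y [Ay xy]] := Ax (eball x r); [apply/nbhs_eball; exists r|exists y].
by have [y Ay xy] := xA r r0; exists y; split => //; exact: rB.
Qed.

Lemma lipschitz_continuous (f : 'rV[R]_d -> R) L :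
  (forall x y, `|f x - f y| <= L * enorm (x - y)) -> continuous f.
Proof.
move=> fL x B /nbhs_ballP[e/= e0 eB].
have L1 : 0 < `|L| + 1 by rewrite ltr_pwDr.
apply/nbhs_eball; exists (e / (`|L| + 1)); first by rewrite divr_gt0.
move=> y; rewrite /eball/= ltr_pdivlMr// => xy; apply: eB; rewrite -ball_normE /=.
apply: le_lt_trans (fL x y) _; apply: le_lt_trans xy.
rewrite mulrC ler_wpM2l ?enorm_ge0//.
by rewrite (le_trans (ler_norm _))// lerDl.
Qed.

Lemma enorm_dist_continuous x : continuous (fun y => enorm (x - y)).
Proof.
apply: (@lipschitz_continuous _ 1) => y z; rewrite mul1r ler_norml lerNl opprB.
have E u v : x - u - (x - v) = v - u by rewrite opprB addrC addrA subrK.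
have := enorm_dist_le (x - y) (x - z); rewrite E (enormB z) => ->; rewrite andbT.
by have := enorm_dist_le (x - z) (x - y); rewrite E.
Qed.

Lemma dot_dist_continuous x v : continuous (fun y => dot (y - x) v).
Proof.
apply: (@lipschitz_continuous _ (enorm v)) => y z.
have -> : dot (y - x) v - dot (z - x) v = dot (y - z) v by rewrite !dotE; lra.
by rewrite mulrC norm_dot_le.
Qed.

End euclidean_topology.

(* Neither function is assumed measurable: the integral of a nonnegative function
   is a supremum over the simple functions below it. *)
Lemma ge0_le_integral_any d (T : measurableType d) (R : realType)
    (mu : {measure set T -> \bar R}) (f g : T -> \bar R) :
  (forall x, 0 <= f x)%E -> (forall x, f x <= g x)%E ->
  (\int[mu]_x f x <= \int[mu]_x g x)%E.
Proof.
move=> f0 fg; rewrite !ge0_integralTE//; last by move=> x; exact: le_trans (fg x).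
apply: ereal_sup_le => _ [h hf <-]; exists h => // x.
exact: le_trans (hf x) (fg x).
Qed.

(** * Lebesgue measure on R^d *)

Section cover_measure.
Context {R : realType} {T I : Type}.
Context (shape : I -> set T) (adm : set I) (gauge : I -> R).
Context (gauge_ge0 : forall i, adm i -> 0 <= gauge i).
Local Notation mu := (cover_measure shape adm gauge).

Lemma slot_ge0 A F : admissible_cover shape adm A F ->
  forall k, (0 <= (oapp gauge 0 (F k))%:E)%E.
Proof.
by move=> [admF _] k; rewrite lee_fin; case E : (F k) => [i|] //=;
  apply/gauge_ge0/(admF k).
Qed.

Lemma cover_measure_shape i : adm i -> (mu (shape i) <= (gauge i)%:E)%E.
Proof.
move=> ai; pose F k := if k is 0%N then Some i else None.
have AF : admissible_cover shape adm (shape i) F.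
  by split=> [[|k] j //= [<-]//|x xi]; exists 0%N.
apply: ereal_inf_lbound; exists F => //.
rewrite (nneseriesD1 (n := 0%N))//=; last by move=> k _; exact: slot_ge0 AF k.
by rewrite eseries0 ?adde0// => -[|k].
Qed.

(** Common core of the measurability proofs: each slot of a cover of [C] is replaced by one slot for
    [A] and one for [B] whose gauges add up to no more than the original one. *)
Lemma cover_measure_split (A B C : set T)
    (f g : option I -> option I) :
  (forall o, (forall i, o = Some i -> adm i) -> forall j, f o = Some j -> adm j) ->
  (forall o, (forall i, o = Some i -> adm i) -> forall j, g o = Some j -> adm j) ->
  (forall F, admissible_cover shape adm C F -> forall k,
    [/\ A `&` oapp shape set0 (F k) `<=` oapp shape set0 (f (F k)),
     B `&` oapp shape set0 (F k) `<=` oapp shape set0 (g (F k)) &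
     oapp gauge 0 (f (F k)) + oapp gauge 0 (g (F k)) <= oapp gauge 0 (F k)]) ->
  A `<=` C -> B `<=` C ->
  (mu A + mu B <= mu C)%E.
Proof.
move=> admf admg fg AC BC; apply: le_ereal_inf_tmp => _ [F CF <-].
have Af : admissible_cover shape adm A (f \o F).
  split=> [k i /=|x Ax]; first by apply: admf => j; exact: CF.1.
  have [k _ kx] := CF.2 _ (AC _ Ax); exists k => //.
  by have [h _ _] := fg _ CF k; apply: h.
have Bg : admissible_cover shape adm B (g \o F).
  split=> [k i /=|x Bx]; first by apply: admg => j; exact: CF.1.
  have [k _ kx] := CF.2 _ (BC _ Bx); exists k => //.
  by have [_ h _] := fg _ CF k; apply: h.
apply: (@le_trans _ _ (\sum_(k <oo) (oapp gauge 0 ((f \o F) k))%:E +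
                       \sum_(k <oo) (oapp gauge 0 ((g \o F) k))%:E)%E).
  by apply: leeD; apply: ereal_inf_lbound; [exists (f \o F)|exists (g \o F)].
rewrite -nneseriesD; last 2 first.
- by move=> k _ _; exact: slot_ge0 Af k.
- by move=> k _ _; exact: slot_ge0 Bg k.
apply: lee_nneseries => [k _ _|k _].
  by apply: adde_ge0; [exact: slot_ge0 Af k|exact: slot_ge0 Bg k].
by rewrite -EFinD lee_fin; have [] := fg _ CF k.
Qed.

End cover_measure.

Lemma outer_measure_fin_bigcup (R : realType) (T : Type)
    (mu : {outer_measure set T -> \bar R}) (I : finType) (A : set T)
    (B : I -> set T) (c : R) :
  A `<=` \bigcup_i B i -> (forall i, mu (B i) <= c%:E)%E ->
  (mu A <= (#|I|%:R * c)%:E)%E.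
Proof.
move=> AB Bc.
have -> : (#|I|%:R * c)%:E = (\sum_(i : I) c%:E)%E.
  by rewrite sumEFin sumr_const mulr_natl.
apply: (@le_trans _ _ (\sum_(i : I) mu (B i))%E); last exact: lee_sum.
apply: le_trans (le_outer_measure mu _ _ AB) _.
have -> : \bigcup_i B i = \big[setU/set0]_(i <- index_enum I) B i.
  by rewrite -bigcup_seq; apply: eq_bigcupl; split => // i _ /=; rewrite mem_index_enum.
elim/big_ind2 : _ => //; first by rewrite outer_measure0.
move=> X1 y1 X2 y2 h1 h2; apply: le_trans (outer_measureU2 _ _ _) _.
exact: leeD.
Qed.

Section lebesgue_open.
Context {R : realType} {n : nat}.
Local Notation d := n.+1.
Implicit Types (x b : 'rV[R]_d) (i : 'I_d) (c : R).
Local Notation outer := (@lebesgue_outer R d).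
Local Notation T := (caratheodory_type outer).

Let set_coord b i c : 'rV[R]_d := \row_j if j == i then c else b 0 j.

Let box_volumeD1 b1 b2 i : box_volume (b1, b2) =
  (b2 0 i - b1 0 i) * \prod_(j | j != i) (b2 0 j - b1 0 j).
Proof. by rewrite /box_volume (bigD1 i). Qed.

(** Each box of a cover is cut by the hyperplane: [f] keeps the lower part and [g] the upper part,
    with [None] when that part is empty. The common face has no volume, so the volumes add up. *)
Lemma measurable_coord_le i c : measurable ([set x | x 0 i <= c] : set T).
Proof.
apply: le_caratheodory_measurable => X.
pose f (o : option ('rV[R]_d * 'rV[R]_d)) : option ('rV[R]_d * 'rV[R]_d) := if o is Some b then
  if b.1 0 i <= c then Some (b.1, set_coord b.2 i (Num.min (b.2 0 i) c))
  else None else None.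
pose g (o : option ('rV[R]_d * 'rV[R]_d)) : option ('rV[R]_d * 'rV[R]_d) := if o is Some b then
  if c <= b.2 0 i then Some (set_coord b.1 i (Num.max (b.1 0 i) c), b.2)
  else None else None.
apply: (@cover_measure_split _ _ _ _ _ _ (@box_volume_ge0 _ _) _ _ _ f g).
- move=> [b|//] /(_ _ erefl) ab j /=; case: ifPn => // bc [<-] k /=.
  rewrite mxE; case: eqVneq => [->|_]; last exact: ab.
  by rewrite le_min ab.
- move=> [b|//] /(_ _ erefl) ab j /=; case: ifPn => // bc [<-] k /=.
  rewrite mxE; case: eqVneq => [->|_]; last exact: ab.
  by rewrite ge_max ab.
- move=> F [admF _] k; case E : (F k) => [[b1 b2]|]/=; last first.
    by split => [x []|x []|]//; rewrite addr0.
  have := admF _ _ E; rewrite /box_adm /= => ab.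
  have P0 : 0 <= \prod_(j | j != i) (b2 0 j - b1 0 j).
    by apply: prodr_ge0 => j _; rewrite subr_ge0.
  have E1 : \prod_(j | j != i) (set_coord b2 i (Num.min (b2 0 i) c) 0 j - b1 0 j)
     = \prod_(j | j != i) (b2 0 j - b1 0 j).
    by apply: eq_bigr => j /negbTE ji; rewrite mxE ji.
  have E2 : \prod_(j | j != i) (b2 0 j - set_coord b1 i (Num.max (b1 0 i) c) 0 j)
     = \prod_(j | j != i) (b2 0 j - b1 0 j).
    by apply: eq_bigr => j /negbTE ji; rewrite mxE ji.
  split.
  + move=> x [[_ /= xc] xb]; rewrite (le_trans _ xc); last by have /andP[] := xb i.
    move=> j /=; rewrite mxE; case: eqVneq => [->|_]; last exact: xb.
    by rewrite le_min xc; have /andP[/= -> ->] := xb i.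
  + move=> x [[_ /= /negP]]; rewrite -ltNge => xc xb.
    rewrite (le_trans (ltW xc)); last by have /andP[] := xb i.
    move=> j /=; rewrite mxE; case: eqVneq => [->|_]; last exact: xb.
    by rewrite ge_max (ltW xc) andbT; have /andP[/= -> ->] := xb i.
  + have := ab i.
    by case: ifPn => h1; case: ifPn => h2 /= bi; rewrite ?(box_volumeD1 _ _ i)
      ?E1 ?E2 ?mxE ?eqxx -?mulrDl ?addr0 ?add0r ?ler_wpM2r//;
      move: h1 h2; rewrite -?ltNge => h1 h2; rewrite ?minEle ?maxEle;
      repeat case: ifPn; rewrite -?ltNge => *; lra.
- by move=> x [].
- by move=> x [].
Qed.

(** Half-spaces of one orientation are at hand; the opposite closed ones are countable intersections
    of complements. *)
Lemma measurable_box ab : measurable (box ab : set T).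
Proof.
have -> : box ab = \bigcap_(i in [set: 'I_d])
    ([set x : 'rV[R]_d | x 0 i <= ab.2 0 i] `&` \bigcap_(k in [set: nat])
       ~` [set x : 'rV[R]_d | x 0 i <= ab.1 0 i - k.+1%:R^-1]).
  apply/seteqP; split=> [x xab i _|x xab i].
    have /andP[h1 h2] := xab i; split => //= k _; apply/negP; rewrite -ltNge.
    by apply: lt_le_trans h1; rewrite ltrBlDr ltrDl invr_gt0.
  have [/= h2 h1] := xab i I; rewrite h2 andbT leNgt; apply/negP.
  move=> xi; have := h1 (Num.truncn (ab.1 0 i - x 0 i)^-1) I; apply => /=.
  have e0 : 0 < ab.1 0 i - x 0 i by rewrite subr_gt0.
  rewrite lerBrDl -lerBrDr -[leRHS]invrK lef_pV2 ?posrE ?invr_gt0//.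
  by apply: ltW; exact: truncnS_gt.
apply: fin_bigcap_measurable => [|i _]; first exact: finite_finset.
apply: measurableI; first exact: measurable_coord_le.
apply: bigcapT_measurable => k; apply: measurableC; exact: measurable_coord_le.
Qed.

(** An open set is the countable union of the boxes with rational corners that it contains. *)
Lemma open_lebesgue_measurable (U : set 'rV[R]_d) :
  open U -> measurable (U : set T).
Proof.
move=> oU.
pose F (ab : 'rV[rat]_d * 'rV[rat]_d) : set 'rV[R]_d :=
  let B := box (map_mx ratr ab.1, map_mx ratr ab.2) in
  if pselect (B `<=` U) then B else set0.
suff -> : U = \bigcup_(ab in setT) F ab.
  apply: countable_bigcupT_measurable => [|ab]; first exact: countableP.
  by rewrite /F; case: pselect => h /=; [exact: measurable_box|exact: measurable0].
apply/seteqP; split => [x Ux|x [ab _]]; last first.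
  by rewrite /F; case: pselect => // h /h.
have /nbhs_ballP[r/= r0 rU] : nbhs x U by apply: open_nbhs_nbhs.
have /choice[a ha] : forall i, exists q : rat, x 0 i - r < ratr q < x 0 i.
  by move=> i; have [|q] := @rat_in_itvoo R (x 0 i - r) (x 0 i);
    [rewrite ltrBlDr ltrDl|rewrite in_itv; exists q].
have /choice[b hb] : forall i, exists q : rat, x 0 i < ratr q < x 0 i + r.
  by move=> i; have [|q] := @rat_in_itvoo R (x 0 i) (x 0 i + r);
    [rewrite ltrDl|rewrite in_itv; exists q].
exists (\row_i a i, \row_i b i) => //; rewrite /F; case: pselect => /=.
  by move=> _ i; rewrite !mxE; have /andP[_ /ltW->] := ha i; have /andP[/ltW->] := hb i.
case=> y yab; apply: rU; rewrite mx_norm_ball /ball_/= [`|_|]mx_normrE bigmax_lt// => -[i j] _ /=.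
rewrite (ord1 i) !mxE ltr_norml; have := yab j; rewrite !mxE.
by have := ha j; have := hb j; lra.
Qed.

Lemma continuous_lebesgue_measurable (f : 'rV[R]_d -> R) :
  continuous f -> measurable_fun setT (f : T -> R).
Proof.
move=> /continuousP cf; apply: (measurability _ (RGenOpens.measurableE R)) => //.
move=> _ [_ [a [b ->]] <-]; rewrite setTI; apply: open_lebesgue_measurable.
exact/cf/interval_open.
Qed.

End lebesgue_open.

(** Selects the coordinate axis closest to [e], hence a coordinate hyperplane onto which projections
    along [e] have controlled slopes. *)
Lemma exists_max_coord {R : realType} {n : nat} (e : 'rV[R]_n.+1) :
  exists j, (forall i, `|e 0 i| <= `|e 0 j|) /\ enorm e <= n.+1%:R * `|e 0 j|.
Proof.
have [j _ jmax] := real_arg_maxP (i0 := ord0 : 'I_n.+1) (P := xpredT)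
  (F := fun i => `|e 0 i|) isT (fun i _ => num_real _).
by exists j; split => [i|]; [|apply: enorm_le_coord => i]; exact: jmax.
Qed.

(** * Invariance of Lebesgue measure under point reflections *)

Section lebesgue_reflection.
Context {R : realType} {n : nat}.
Local Notation d := n.+1.
Implicit Types (x y : 'rV[R]_d) (A D : set 'rV[R]_d).
Local Notation outer := (@lebesgue_outer R d).
Local Notation T := (caratheodory_type outer).

Definition reflect_pt x y := x + x - y.

Lemma reflect_ptK x : involutive (reflect_pt x).
Proof. by move=> y; exact: subKr. Qed.

(** A reflected box is a box of the same volume with exchanged corners. One inequality suffices, the
    reflection being an involution. *)
Lemma lebesgue_outer_reflect x A : outer (reflect_pt x @^-1` A) = outer A.
Proof.
suff le B : (outer (reflect_pt x @^-1` B) <= outer B)%E.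
  apply/eqP; rewrite eq_le le andTb -[in leLHS](_ : reflect_pt x @^-1` (reflect_pt x @^-1` A) = A) ?le//.
  by apply/seteqP; split => y; rewrite /preimage/= reflect_ptK.
apply: le_ereal_inf_tmp => _ [F [admF BF] <-].
pose h (ab : 'rV[R]_d * 'rV[R]_d) := (reflect_pt x ab.2, reflect_pt x ab.1).
apply: ereal_inf_lbound; exists (omap h \o F).
  split=> [k ab /=|y /BF[k _ ky]].
    case E : (F k) => [ab'|//] [<-] i; have := admF _ _ E i.
    by rewrite !mxE lerBrDl addrCA gerDl subr_le0.
  exists k => //; move: ky => /=; case: (F k) => [ab'|//] /= yab i.
  by have := yab i; rewrite !mxE => /andP[? ?]; apply/andP; split; lra.
apply: eq_eseriesr => k _ /=; case: (F k) => [ab|]//=; congr EFin.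
by apply: eq_bigr => i _; rewrite !mxE; ring.
Qed.

Lemma measurable_reflect x : measurable_fun setT (reflect_pt x : T -> T).
Proof.
move=> _ A mA; have {}mA : outer.-caratheodory A := mA.
rewrite setTI.
suff : outer.-caratheodory (reflect_pt x @^-1` A) by [].
move=> X; rewrite -(lebesgue_outer_reflect x X) mA.
by congr (_ + _)%E; rewrite -[in RHS](lebesgue_outer_reflect x); congr (outer _);
  apply/seteqP; split => y; rewrite /preimage/= reflect_ptK.
Qed.

Lemma integral_reflect x D (f : T -> \bar R) :
  measurable (D : set T) -> measurable_fun (D : set T) f -> (forall y, 0 <= f y)%E ->
  (\int[lebesgue_Rd R d]_(y in reflect_pt x @^-1` D) f (reflect_pt x y) =
   \int[lebesgue_Rd R d]_(y in D) f y)%E.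
Proof.
move=> mD mf f0.
rewrite -(ge0_integral_pushforward (measurable_reflect x))//.
apply: eq_measure_integral => [|mphi A mA DA]; first exact: (measurable_reflect x).
exact: (lebesgue_outer_reflect x A).
Qed.

End lebesgue_reflection.

(** * Volumes of balls and thin slabs *)

Section lebesgue_volumes.
Context {R : realType} {n : nat}.
Local Notation d := n.+1.
Implicit Types (x y e : 'rV[R]_d) (q t : R).
Local Notation outer := (@lebesgue_outer R d).

Lemma lebesgue_outer_box ab : @box_adm R d ab -> (outer (box ab) <= (box_volume ab)%:E)%E.
Proof. exact: (cover_measure_shape _ (@box_volume_ge0 R d)). Qed.

Lemma lebesgue_outer_ball x q : 0 < q ->
  (outer (eball x q) <= ((2 * q) ^+ d)%:E)%E.
Proof.
move=> q0; pose b (c : R) : 'rV[R]_d := \row_i (x 0 i + c).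
apply: (@le_trans _ _ (outer (box (b (- q), b q)))).
  apply: le_outer_measure => y xy i; rewrite !mxE /=.
  have := le_lt_trans (coord_le_enorm (x - y) i) xy.
  by rewrite !mxE ltr_norml => /andP[? ?]; apply/andP; split; lra.
have -> : (2 * q) ^+ d = box_volume (b (- q), b q).
  rewrite /box_volume (eq_bigr (fun=> 2 * q)) ?prodr_const ?card_ord// => i _.
  by rewrite !mxE /=; ring.
apply: lebesgue_outer_box => i /=; rewrite !mxE; lra.
Qed.

Definition slab x e q t : set 'rV[R]_d :=
  [set y | enorm (x - y) < q /\ `|dot (y - x) e| <= t].

(* The slab is a graph of thickness O(t) over a coordinate hyperplane
   transversal to e: it is covered by one box of height O(t) over each cell of
   a grid of mesh about t. *)
Let slab_small x e q t : enorm e = 1 -> 0 < t <= q ->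
  (outer (slab x e q t) <= ((2 * d%:R * (1 + 2 * n%:R) * 2 ^+ n) * t * q ^+ n)%:E)%E.
Proof.
move=> e1 /andP[t0 tq].
have q0 : 0 < q by exact: lt_le_trans tq.
have [j [jmax ej]] := exists_max_coord e.
rewrite e1 in ej.
have ej0 : 0 < `|e 0 j|.
  by rewrite lt_def normr_ge0 andbT; apply/negP => /eqP h; move: ej; rewrite h mulr0 ler10.
(* The number of cells per axis: the mesh [h = 2 q / N] of the grid on a cube of side [2 q] is then
   at most [2 t]. *)
pose N := (Num.trunc (q / t)).+1.
have N0 : 0 < N%:R :> R by rewrite ltr0n.
have qN : q / N%:R <= t.
  by rewrite ler_pdivrMr// mulrC -ler_pdivrMr// ltW// truncnS_gt.
pose h := 2 * q / N%:R.
have h0 : 0 < h by rewrite divr_gt0// mulr_gt0.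
have ht : h <= 2 * t by rewrite /h -mulrA ler_pM2l.
pose w := d%:R * (1 + 2 * n%:R) * t.
have w0 : 0 < w by rewrite /w !mulr_gt0// addr_gt0// ?ltr01// mulr_ge0.
pose cell (f : {ffun 'I_n -> 'I_N}) i := x 0 (lift j i) - q + h * (f i)%:R.
(* Height, above the lower corner of the cell, of the hyperplane through [x] orthogonal to [e]. *)
pose c f := x 0 j - (\sum_i e 0 (lift j i) * (cell f i - x 0 (lift j i))) / e 0 j.
pose lo f : 'rV[R]_d := \row_k if unlift j k is Some i then cell f i else c f - w.
pose hi f : 'rV[R]_d := \row_k if unlift j k is Some i then cell f i + h else c f + w.
have vol f : box_volume (lo f, hi f) = 2 * w * h ^+ n.
  rewrite /box_volume (bigD1_ord j)//= !mxE unlift_none; congr (_ * _); first by ring.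
  rewrite (eq_bigr (fun=> h)) ?prodr_const ?card_ord// => i _.
  by rewrite !mxE liftK; ring.
have -> : 2 * d%:R * (1 + 2 * n%:R) * 2 ^+ n * t * q ^+ n =
    #|{: {ffun 'I_n -> 'I_N}}|%:R * (2 * w * h ^+ n).
  rewrite card_ffun !card_ord natrX.
  rewrite [RHS]mulrCA -exprMn_comm; last exact: mulrC.
  have -> : N%:R * h = 2 * q by rewrite /h mulrC divfK// gt_eqF.
  by rewrite exprMn_comm /w; [ring|exact: mulrC].
apply: (outer_measure_fin_bigcup (B := fun f => box (lo f, hi f))); last first.
  move=> f; rewrite -(vol f); apply: lebesgue_outer_box.
  by move=> k /=; rewrite !mxE; case: unliftP => [i _|_]; lra.
move=> y [yq yt].
have yi k : `|y 0 k - x 0 k| < q.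
  apply: le_lt_trans yq; rewrite enormB.
  by apply: le_trans (coord_le_enorm _ k); rewrite !mxE.
pose g i := (y 0 (lift j i) - x 0 (lift j i) + q) / h.
have g0 i : 0 <= g i.
  by rewrite divr_ge0 ?(ltW h0)//; have := yi (lift j i); rewrite ltr_norml; lra.
have gN i : (Num.trunc (g i) < N)%N.
  rewrite -(ltr_nat R); apply: (@le_lt_trans _ _ (g i)).
    by have /andP[] := truncn_itv (g0 i).
  rewrite ltr_pdivrMr// /h mulrC divfK ?gt_eqF//.
  by have := yi (lift j i); rewrite ltr_norml; lra.
pose f : {ffun 'I_n -> 'I_N} := [ffun i => Ordinal (gN i)].
have fcell i : cell f i <= y 0 (lift j i) <= cell f i + h.
  rewrite /cell ffunE /=.
  have /andP[h1 /ltW h2] := truncn_itv (g0 i).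
  have gE : h * g i = y 0 (lift j i) - x 0 (lift j i) + q.
    by rewrite /g mulrC divfK ?gt_eqF.
  have k1 : h * (Num.trunc (g i))%:R <= h * g i by rewrite ler_pM2l.
  have k2 : h * g i <= h * (Num.trunc (g i)).+1%:R by rewrite ler_pM2l.
  rewrite -natr1 mulrDr mulr1 in k2.
  by apply/andP; split; lra.
exists f => // k; rewrite !mxE /=; case: unliftP => [i ->|->]; first exact: fcell.
suff : `|y 0 j - c f| <= w by rewrite ler_norml; lra.
rewrite -(ler_pM2l ej0) -normrM.
have -> : e 0 j * (y 0 j - c f) = dot (y - x) e -
    \sum_i e 0 (lift j i) * (y 0 (lift j i) - cell f i).
  have -> : dot (y - x) e = e 0 j * (y 0 j - x 0 j) +
      \sum_i e 0 (lift j i) * (y 0 (lift j i) - x 0 (lift j i)).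
    rewrite /dot (bigD1_ord j)//= !mxE mulrC; congr (_ + _).
    by apply: eq_bigr => i _; rewrite !mxE mulrC.
  rewrite -addrA -sumrB.
  rewrite (eq_bigr (fun i => e 0 (lift j i) * (cell f i - x 0 (lift j i)))).
    by rewrite /c; set S := \sum_i _; field; rewrite -normr_gt0.
  by move=> i _; ring.
apply: le_trans (ler_normB _ _) _.
apply: (@le_trans _ _ (t + n%:R * (`|e 0 j| * h))).
  apply: lerD => //; apply: le_trans (ler_norm_sum _ _ _) _.
  have -> : n%:R * (`|e 0 j| * h) = \sum_(i < n) (`|e 0 j| * h).
    by rewrite sumr_const card_ord mulr_natl.
  apply: ler_sum => i _; rewrite normrM ler_pM//.
  by rewrite ler_norml; have := fcell i; lra.
(* The first summand absorbs the thickness [t], as [d |e_j| >= 1]; the second one absorbs the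
   variation of the hyperplane over a cell. *)
have E : `|e 0 j| * w = (d%:R * `|e 0 j|) * t + n%:R * (`|e 0 j| * (2 * t)) * d%:R.
  rewrite /w; ring.
rewrite E; apply: lerD; first by rewrite ler_pMl.
rewrite -[leLHS]mulr1; apply: ler_pM; rewrite ?ler1n//.
  by rewrite !mulr_ge0// ltW.
by rewrite ler_wpM2l// ler_wpM2l.
Qed.

(** Extends the covering estimate to all [t >= 0]: a slab with [t = 0] lies in arbitrarily thin
    ones, and for [t > q] the ball already forces thickness [q]. *)
Lemma slab_volume : exists2 C : R, 0 < C & forall x e q t,
  enorm e = 1 -> 0 < q -> 0 <= t ->
  (outer (slab x e q t) <= (C * t * q ^+ n)%:E)%E.
Proof.
set C := 2 * d%:R * (1 + 2 * n%:R) * 2 ^+ n : R.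
have C0 : 0 < C by rewrite /C !mulr_gt0 ?exprn_gt0// ltr_pwDl// mulr_ge0.
exists C => // x e q t e1 q0; rewrite le_eqVlt => /predU1P[<-|t0].
  rewrite mulr0 mul0r; apply/lee_addgt0Pr => eps eps0; rewrite add0e.
  have Cq : 0 < C * q ^+ n by rewrite mulr_gt0 ?exprn_gt0.
  pose u := Num.min q (eps / (C * q ^+ n)).
  have u0 : 0 < u by rewrite lt_min q0 divr_gt0.
  apply: (@le_trans _ _ (outer (slab x e q u))).
    by apply: le_outer_measure => y [yq y0]; split => //; rewrite (le_trans y0)// ltW.
  apply: le_trans (slab_small _ e1 _) _; first by rewrite u0 ge_min lexx.
  rewrite lee_fin -/C mulrAC.
  by rewrite -ler_pdivlMl// mulrC ge_min lexx orbT.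
have [tq|/ltW qt] := leP t q; first by apply: slab_small; rewrite ?t0.
apply: (@le_trans _ _ (outer (slab x e q q))).
  apply: le_outer_measure => y [yq _]; split => //.
  rewrite (le_trans (norm_dot_le _ _))// e1 mulr1 enormB; exact: ltW.
apply: le_trans (slab_small _ e1 _) _; first by rewrite q0 lexx.
by rewrite lee_fin -/C ler_pM2r ?exprn_gt0// ler_pM2l.
Qed.

End lebesgue_volumes.

(** * Hausdorff measure *)

Lemma sum_odd_even {R : realType} (f : nat -> \bar R) N :
  (\sum_(i < N.*2) f i = \sum_(i < N) f i.*2 + \sum_(i < N) f i.*2.+1)%E.
Proof.
elim: N => [|N IH]; first by rewrite !big_ord0 adde0.
by rewrite doubleS !big_ord_recr /= IH -!addeA; congr (_ + _)%E; rewrite addeCA.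
Qed.

Section hausdorff_metric_outer_measure.
Context {R : realType} (m n : nat).
Local Notation d := n.+1.
Implicit Types (x y z : 'rV[R]_d) (A B C F : set 'rV[R]_d) (r delta : R).
Local Notation H := (@hausdorff_outer R m d).
Local Notation pre := (@hausdorff_pre R m d).

Lemma hausdorff_pre_ge0 delta A : (0 <= pre delta A)%E.
Proof. exact/cover_measure_ge0/hausdorff_gauge_ge0. Qed.

Lemma hausdorff_pre_le delta A : 0 < delta -> (pre delta A <= H A)%E.
Proof. by move=> d0; apply: ereal_sup_ubound; exists delta. Qed.

Lemma hausdorff_pre_antitone delta1 delta2 A : delta1 <= delta2 ->
  (pre delta2 A <= pre delta1 A)%E.
Proof.
move=> d12; apply: ereal_inf_le_tmp => _ [F [admF AF] <-].
exists F => //; split => // k C FC x y Cx Cy.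
exact: le_trans (admF k C FC x y Cx Cy) d12.
Qed.

(** A set of diameter at most [delta < r] cannot meet both [A] and [B], so each slot of a cover is
    charged to at most one of them; [meet X] drops the slots missing [X]. *)
Lemma hausdorff_pre_separated delta r A B C : delta < r ->
  (forall a b, A a -> B b -> r <= enorm (a - b)) ->
  A `<=` C -> B `<=` C -> (pre delta A + pre delta B <= pre delta C)%E.
Proof.
move=> dr AB AC BC.
pose meet X (o : option (set 'rV[R]_d)) :=
  if o is Some Y then if pselect (X `&` Y !=set0) then Some Y else None else None.
have admmeet X o : (forall i, o = Some i -> small_diam delta i) ->
    forall j, meet X o = Some j -> small_diam delta j.
  by case: o => [Y|//] h j /=; case: pselect => // nX [<-]; exact: h.
have meetX X o : X `&` oapp id set0 o `<=` oapp id set0 (meet X o).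
  case: o => [Y|] x /= [Xx Yx] //; case: pselect => //=.
  by case; exists x.
apply: (@cover_measure_split _ _ _ _ _ _ (@hausdorff_gauge_ge0 R m d delta)
  _ _ _ (meet A) (meet B)) => //; try exact: admmeet.
move=> F [admF _] k; split; [exact: meetX|exact: meetX|].
case E : (F k) => [Y|]/=; last by rewrite addr0.
have g0 := hausdorff_gauge_ge0 m (admF _ _ E).
case: pselect => [[a [Aa Ya]]|nA]; case: pselect => [[b [Bb Yb]]|nB] //=;
  rewrite ?add0r ?addr0//.
by have := lt_le_trans dr (AB _ _ Aa Bb); rewrite ltNge (admF _ _ E).
Qed.

(** Both premeasures are compared at a common scale below [r]. The two suprema are then taken one
    after the other, which requires finite values for the subtractions. *)
Lemma hausdorff_separated r A B C : 0 < r ->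
  (forall a b, A a -> B b -> r <= enorm (a - b)) ->
  A `<=` C -> B `<=` C -> (H A + H B <= H C)%E.
Proof.
move=> r0 AB AC BC.
have [->|HCfin] := eqVneq (H C) +oo%E; first by rewrite leey.
have key d1 d2 : 0 < d1 -> 0 < d2 -> (pre d1 A + pre d2 B <= H C)%E.
  move=> d10 d20; pose dl := Num.min (r / 2) (Num.min d1 d2).
  have dl0 : 0 < dl by rewrite !lt_min divr_gt0// d10.
  apply: le_trans (hausdorff_pre_le C dl0).
  have dlr : dl < r by rewrite gt_min; apply/orP; left; lra.
  apply: le_trans (hausdorff_pre_separated dlr AB AC BC).
  by apply: leeD; apply: hausdorff_pre_antitone; rewrite !ge_min lexx ?orbT.
have HCf : H C \is a fin_num.
  by rewrite ge0_fin_numE ?lt_neqAle ?HCfin ?leey// hausdorff_outer_ge0.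
have fin X delta : 0 < delta -> X `<=` C -> pre delta X \is a fin_num.
  move=> dl0 XC; rewrite ge0_fin_numE ?hausdorff_pre_ge0//.
  apply: le_lt_trans (hausdorff_pre_le _ dl0) _.
  apply: le_lt_trans (le_hausdorff_outer m XC) _.
  by rewrite -ge0_fin_numE// hausdorff_outer_ge0.
have HBf : H B \is a fin_num.
  rewrite ge0_fin_numE ?hausdorff_outer_ge0//.
  apply: le_lt_trans (le_hausdorff_outer m BC) _.
  by rewrite -ge0_fin_numE// hausdorff_outer_ge0.
rewrite -leeBrDr//; apply: ge_ereal_sup => _ [d1 /= d10 <-].
rewrite leeBrDr// addeC -leeBrDr ?fin//.
apply: ge_ereal_sup => _ [d2 /= d20 <-].
by rewrite leeBrDr ?fin// addeC key.
Qed.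

(* Caratheodory's criterion: the shells of a set A at distance between
   1/(k+2) and 1/(k+1) from a closed set F are separated in steps of two, so
   that their measures are summable. *)
Section closed_sets.
Variables (F A : set 'rV[R]_d).

Let far k : set 'rV[R]_d :=
  [set y | A y /\ forall z, F z -> k.+1%:R^-1 <= enorm (y - z)].
Let shell k := far k.+1 `\` far k.

Let farS k j : (k <= j)%N -> far k `<=` far j.
Proof.
move=> kj y [Ay yF]; split => // z /yF; apply: le_trans.
by rewrite lef_pV2 ?posrE// ler_nat.
Qed.

Let far_shell_separated k j y z : (k < j)%N -> far k y -> shell j z ->
  k.+1%:R^-1 - k.+2%:R^-1 <= enorm (y - z).
Proof.
move=> kj [_ yF] [[Az _] /not_andP[//|/existsNP[w /not_implyP[Fw /negP]]]].
rewrite -ltNge => zw.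
apply: (@le_trans _ _ (enorm (y - w) - enorm (z - w))).
  apply: lerB; first exact: yF.
  by apply: ltW; apply: lt_le_trans zw _; rewrite lef_pV2 ?posrE// ler_nat.
by rewrite lerBlDr (le_trans (enorm_distD z _ _)).
Qed.

Let sep_gt0 k : 0 < k.+1%:R^-1 - k.+2%:R^-1 :> R.
Proof. by rewrite subr_gt0 ltf_pV2 ?posrE// ltr_nat. Qed.

(** The offsets [b = 0] and [b = 1] give the shells of odd and of even index. Within one parity a
    full shell lies between two neighbours, so their measures add up. *)
Let shell_sum b N :
  (\sum_(i < N) H (shell (i.*2 + b).+1) <= H (far (N.*2 + b)))%E.
Proof.
elim: N => [|N IH]; first by rewrite big_ord0 hausdorff_outer_ge0.
rewrite big_ord_recr /=; apply: le_trans (leeD2r _ IH) _.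
apply: (hausdorff_separated (sep_gt0 (N.*2 + b))).
- by move=> y z; exact: far_shell_separated.
- by apply: farS; rewrite doubleS !addSn; do 2 apply: leqW.
- by rewrite doubleS !addSn => y [].
Qed.

Let farA k : far k `<=` A. Proof. by move=> y []. Qed.

Let shells_lty : (H A < +oo)%E -> (\sum_(k <oo) H (shell k.+1) < +oo)%E.
Proof.
move=> HA; apply: (@le_lt_trans _ _ (H A + H A)%E); last exact: lte_add_pinfty.
apply: lime_le.
  by apply: is_cvg_nneseries => k _ _; exact: hausdorff_outer_ge0.
apply: nearW => N; rewrite big_mkord.
apply: (@le_trans _ _ (\sum_(i < N.*2) H (shell i.+1))%E).
  rewrite -!(big_mkord xpredT (fun i => H (shell i.+1))).
  apply: lee_sum_nneg_natr => [k _ _|]; first exact: hausdorff_outer_ge0.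
  by rewrite -addnn leq_addr.
rewrite (sum_odd_even (fun i => H (shell i.+1))); apply: leeD.
  under eq_bigr do rewrite -[_.*2]addn0.
  by apply: le_trans (shell_sum 0 N) _; exact/le_hausdorff_outer/farA.
under eq_bigr do rewrite -[_.*2.+1]addn1.
by apply: le_trans (shell_sum 1 N) _; exact/le_hausdorff_outer/farA.
Qed.

(** Closedness of [F] puts every point of its complement at positive distance, hence in some
    [far N]; past [far k.+1] it lies in one of the later shells. *)
Let cover_shells k : closed F ->
  A `&` ~` F `<=` far k.+1 `|` \bigcup_j shell (j + k).+1.
Proof.
move=> cF y [Ay nFy].
have [r r0 yr] : exists2 r, 0 < r & eball y r `<=` ~` F.
  by apply/nbhs_eball; apply: open_nbhs_nbhs; split => //; exact: closed_openC.
have [N Ny] : exists N, far N y.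
  exists (Num.trunc r^-1); split=> // z Fz; rewrite leNgt; apply/negP => yz.
  suff : (~` F) z by apply.
  apply: yr; apply: lt_trans yz _.
  by rewrite -[ltRHS]invrK ltf_pV2 ?posrE ?invr_gt0// truncnS_gt.
elim: N Ny => [|N IH] Ny; first by left; apply: farS Ny.
have [Nk|kN] := leqP N k; first by left; apply: farS Ny; rewrite ltnS.
have [/IH//|Ny'] := pselect (far N y).
by right; exists (N - k.+1)%N => //; rewrite -addnS subnK.
Qed.

Lemma hausdorff_split_closed : closed F -> (H (A `&` F) + H (A `&` ~` F) <= H A)%E.
Proof.
move=> cF; have [->|HAfin] := eqVneq (H A) +oo%E; first by rewrite leey.
have HA : (H A < +oo)%E by rewrite lt_neqAle HAfin leey.
apply/lee_addgt0Pr => e e0.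
have e0' : (0 < e%:E)%E by rewrite lte_fin.
have [k _ /(_ k (leqnn k)) tail] :=
  nneseries_tail_cvg (shells_lty HA) (fun k _ => hausdorff_outer_ge0 _ _)
    (open_ereal_lt' e0').
(* Discarding a tail of shells of measure at most [e] leaves [far k.+1], which is separated from [F]
   by [1 / (k+2)]. *)
apply: (@le_trans _ _ (H (A `&` F) + (H (far k.+1) + e%:E))%E).
  apply: leeD2l; apply: le_trans (le_hausdorff_outer m (@cover_shells k cF)) _.
  apply: le_trans (outer_measureU2 _ _ _) _; apply: leeD2l.
  apply: le_trans (outer_measure_sigma_subadditive _ _) _.
  rewrite (nneseries_addn (f := fun j => H (shell j.+1)))//.
    exact/ltW/tail.
  by move=> i; exact: hausdorff_outer_ge0.
rewrite addeA; apply: leeD2r.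
apply: (hausdorff_separated (r := k.+2%:R^-1)) => //.
by move=> a b [_ Fa] [_ /(_ _ Fa)]; rewrite enormB.
Qed.

End closed_sets.

Lemma closed_hausdorff_measurable F :
  closed F -> measurable (F : set (caratheodory_type H)).
Proof.
by move=> cF; apply: le_caratheodory_measurable => X; exact: hausdorff_split_closed.
Qed.

End hausdorff_metric_outer_measure.

(** * Lower bounds for Hausdorff measure from volumes of cubes *)

Section cube_covers.
Context {R : realType}.
Implicit Types (q : R) (p : pred nat) (w : nat -> R) (c : nat -> nat -> R).

(* Induction on the dimension, integrating the inequality for the sections over
   the last coordinate. *)
Lemma cube_cover_volume (m : nat) q p w c : 0 <= q -> (forall k, 0 <= w k) ->
  (forall x : nat -> R, (forall i, (i < m)%N -> 0 <= x i <= q) ->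
    exists2 k, p k & forall i, (i < m)%N -> c k i - w k <= x i <= c k i + w k) ->
  ((q ^+ m)%:E <= \sum_(k <oo) (if p k then (2 * w k) ^+ m else 0)%:E)%E.
Proof.
move=> q0 w0; elim: m p => [|m IH] p cov.
  (* In dimension 0 every cube weighs 1, whatever its width: [p] has to discard the absent ones. *)
  have [//|k pk _] := cov (fun=> 0).
  rewrite (nneseriesD1 (n := k)) ?pk ?expr0//; last first.
    by move=> j _; rewrite lee_fin; case: ifP.
  by rewrite leeDl// nneseries_ge0// => j _ _; rewrite lee_fin; case: ifP.
pose I k := `[c k m - w k, c k m + w k]%classic : set R.
have mI k : measurable (I k) by exact: measurable_itv.
pose f k (t : R) := ((if p k then (2 * w k) ^+ m else 0) * \1_(I k) t)%:E.
have f0 k t : (0 <= f k t)%E.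
  by rewrite lee_fin mulr_ge0//; case: ifP => // _; rewrite exprn_ge0// mulr_ge0.
have mf k : measurable_fun setT (f k).
  apply/measurable_EFinP; apply: measurable_funM; first exact: measurable_cst.
  exact: measurable_indic.
have sect t : 0 <= t <= q -> ((q ^+ m)%:E <= \sum_(k <oo) f k t)%E.
  (* The cubes that meet the section at [t]; those sections have the same half-widths [w]. *)
  move=> tq; pose pt k := p k && (t \in I k).
  have -> : (\sum_(k <oo) f k t = \sum_(k <oo) (if pt k then (2 * w k) ^+ m else 0)%:E)%E.
    apply: eq_eseriesr => k _; rewrite /f /pt indicE.
    by case: (p k); case: (t \in I k); rewrite ?mulr1 ?mulr0 ?mul0r.
  apply: IH => x xq.
  have [|k pk kx] := cov (fun i => if i == m then t else x i).
    move=> i; rewrite ltnS leq_eqVlt; case: (eqVneq i m) => [_ _|_ /=]; first exact: tq.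
    exact: xq.
  exists k.
    rewrite /pt pk; apply/mem_set; rewrite /I /= in_itv /=.
    by have := kx m (ltnSn m); rewrite eqxx.
  move=> i im; have := kx i (leqW im); case: (eqVneq i m) => // im'.
  by rewrite im' ltnn in im.
have mu0q : lebesgue_measure (`[0, q]%classic : set R) = q%:E.
  rewrite lebesgue_measure_itv/= lte_fin; case: ifPn => [_|]; first by rewrite oppr0 adde0.
  by rewrite -leNgt => q0'; congr EFin; apply/eqP; rewrite eq_le q0.
have muI k : lebesgue_measure (I k) = (2 * w k)%:E.
  rewrite /I lebesgue_measure_itv/= lte_fin; case: ifPn => [_|].
    by rewrite -EFinD; congr EFin; ring.
  by rewrite -leNgt => h; congr EFin; have := w0 k; lra.
rewrite exprSr EFinM -mu0q -integral_cst//.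
apply: (@le_trans _ _ (\int[lebesgue_measure]_(t in `[0%R, q]) \sum_(k <oo) f k t)%E).
  apply: ge0_le_integral => //.
  - by move=> t _; rewrite lee_fin exprn_ge0.
  - apply: ge0_emeasurable_sum => [k t _ _|k _]; first exact: f0.
    exact: measurable_funTS (mf k).
rewrite integral_nneseries//; last by move=> k; exact: measurable_funTS (mf k).
apply: lee_nneseries => [k _ _|k _]; first exact: integral_ge0.
apply: (@le_trans _ _ (\int[lebesgue_measure]_t f k t)%E).
  by apply: ge0_subset_integral => //; exact: (mf k).
have -> : (\int[lebesgue_measure]_t f k t =
    (if p k then (2 * w k) ^+ m else 0)%:E * \int[lebesgue_measure]_t (\1_(I k) t)%:E)%E.
  rewrite -ge0_integralZl_EFin//.
  - by apply/measurable_EFinP; exact: (measurable_indic (mI k)).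
  - by case: ifP => // _; rewrite exprn_ge0// mulr_ge0.
rewrite integral_indic; [|exact: measurableT|exact: mI].
rewrite setIT; have := muI k => /= ->.
rewrite -EFinM lee_fin.
by case: ifP => _; rewrite ?mul0r// exprSr.
Qed.

End cube_covers.

Section hausdorff_lower_bounds.
Context {R : realType} (m d : nat).
Implicit Types (x y z : 'rV[R]_d) (A C : set 'rV[R]_d).

Lemma enorm_le_diam delta C x y : small_diam delta C -> C x -> C y ->
  enorm (x - y) <= diam C.
Proof.
move=> dC Cx Cy; apply: ub_le_sup; last by exists x => //; exists y.
by exists delta => _ [z Cz [z' Cz' <-]]; exact: dC.
Qed.

(** The image under [P] of a set of diameter [D] lies in a cube of side [2 L D], whereas its gauge
    is the unit ball volume times [(D/2)^m]; the quotient [1 / (4 L)] is the constant. The images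
    cover a cube of side [q], so their volumes sum to at least [q^m]. *)
Lemma hausdorff_lipschitz_cube A (P : 'rV[R]_d -> 'I_m -> R) (L q : R) :
  0 < L -> 0 <= q ->
  (forall y z i, `|P y i - P z i| <= L * enorm (y - z)) ->
  (forall x : 'I_m -> R, (forall i, 0 <= x i <= q) ->
    exists2 y, A y & forall i, P y i = x i) ->
  ((unit_ball_volume R m / (4 * L) ^+ m * q ^+ m)%:E <= hausdorff_outer m A)%E.
Proof.
move=> L0 q0 PL cube.
(* The scale 1 serves only to bound the shapes, so that [diam] is a genuine supremum. *)
apply: (@le_trans _ _ (hausdorff_pre m 1 A)); last first.
  by apply: ereal_sup_ubound; exists 1 => /=.
apply: le_ereal_inf_tmp => _ [F [admF AF] <-].
pose D k := oapp id set0 (F k).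
pose p k := `[< D k !=set0 >].
have /choice[z Dz] : forall k, exists z, p k -> D k z.
  move=> k; have [[z Dz]|nz] := pselect (D k !=set0); first by exists z.
  by exists 0 => /asboolP.
pose c k i := if insub i is Some i' then P (z k) i' else 0.
pose w k := L * diam (D k).
have w0 k : 0 <= w k by rewrite mulr_ge0 ?diam_ge0// ltW.
have Dsmall k : small_diam 1 (D k).
  by rewrite /D; case E : (F k) => [C|]/=; [exact: admF E|move=> ? ? []].
have cov (x : nat -> R) : (forall i, (i < m)%N -> 0 <= x i <= q) ->
    exists2 k, p k & forall i, (i < m)%N -> c k i - w k <= x i <= c k i + w k.
  move=> xq; have [|y Ay Py] := cube (fun i => x i); first by move=> i; exact: xq.
  have [k _ Dy] := AF y Ay; have pk : p k by apply/asboolP; exists y.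
  exists k => // i im; rewrite /c insubT.
  have := PL y (z k) (Ordinal im); rewrite Py /= => /le_trans.
  have /ler_wpM2l := enorm_le_diam (Dsmall k) Dy (Dz k pk).
  by move=> /(_ _ (ltW L0)) h /(_ _ h); rewrite ler_norml -/(w k); lra.
have := cube_cover_volume q0 w0 cov.
set S := (\sum_(k <oo) _)%E => qS.
have K0 : 0 <= unit_ball_volume R m / (4 * L) ^+ m.
  by rewrite divr_ge0 ?exprn_ge0 ?mulr_ge0// ltW// unit_ball_volume_gt0.
rewrite EFinM; apply: le_trans (lee_wpmul2l _ qS) _; first by rewrite lee_fin.
rewrite -nneseriesZl; last first.
  by move=> k _; rewrite lee_fin; case: ifP => // _; rewrite exprn_ge0// mulr_ge0.
apply: lee_nneseries => [k _ _|k _].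
  by rewrite mule_ge0// lee_fin; case: ifP => // _; rewrite exprn_ge0// mulr_ge0.
rewrite -EFinM lee_fin; have := Dsmall k; rewrite /p /w /D.
case: (F k) => [C|]/= sC; last first.
  by case: asboolP => [[? []]|_]; rewrite mulr0.
case: asboolP => [_|_]; last by rewrite mulr0 (hausdorff_gauge_ge0 _ sC).
rewrite /hausdorff_gauge mulrAC -mulrA -expr_div_n le_eqVlt; apply/orP; left.
apply/eqP; congr (_ * _ ^+ _); field; lra.
Qed.

End hausdorff_lower_bounds.

(** The factor [4 * 2] belongs to a map of Lipschitz constant 2, and [n.+1] to the side [r / n.+1]
    of a cube fitting in a disc of radius [r]. *)
Definition line_constant (R : realType) (n : nat) : R :=
  unit_ball_volume R n / (4 * 2) ^+ n / n.+1%:R ^+ n.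

Lemma line_constant_gt0 (R : realType) (n : nat) : 0 < line_constant R n.
Proof. by rewrite !divr_gt0 ?exprn_gt0 ?unit_ball_volume_gt0. Qed.

(* The 2-Lipschitz projection along w onto the coordinate hyperplane most
   transversal to w maps A onto a set containing a cube of side r / n.+1. *)
Lemma hausdorff_lines {R : realType} (n : nat) (A : set 'rV[R]_n.+1)
    (c w : 'rV[R]_n.+1) (r : R) : w != 0 -> 0 <= r ->
  (forall delta : 'rV[R]_n.+1, enorm delta <= r ->
     exists t : R, A (c + delta + t *: w)) ->
  ((line_constant R n * r ^+ n)%:E <= hausdorff_outer n A)%E.
Proof.
move=> w0 r0 lines; rewrite /line_constant.
have [j [jmax wj]] := exists_max_coord w.
have wj0 : w 0 j != 0.
  apply: contra w0 => /eqP wj0; apply/eqP/enorm_eq0/eqP.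
  by rewrite eq_le enorm_ge0 andbT; move: wj; rewrite wj0 normr0 mulr0.
(* Constant along the direction [w]; its slopes are at most 1 by the choice of [j], whence the
   Lipschitz constant 2. *)
pose P (y : 'rV[R]_n.+1) i :=
  (y 0 (lift j i) - c 0 (lift j i)) - (y 0 j - c 0 j) * (w 0 (lift j i) / w 0 j).
have -> : unit_ball_volume R n / (4 * 2) ^+ n / n.+1%:R ^+ n * r ^+ n =
    unit_ball_volume R n / (4 * 2) ^+ n * (r / n.+1%:R) ^+ n.
  by rewrite expr_div_n mulrAC mulrA.
apply: (hausdorff_lipschitz_cube (P := P)) => //.
- by rewrite divr_ge0.
- move=> y z i.
  have -> : P y i - P z i = (y - z) 0 (lift j i) - (y - z) 0 j * (w 0 (lift j i) / w 0 j).
    by rewrite /P !mxE; ring.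
  apply: le_trans (ler_normB _ _) _; rewrite mulrDl mul1r lerD ?coord_le_enorm//.
  rewrite normrM -[leRHS]mulr1 ler_pM// ?coord_le_enorm//.
  by rewrite normrM normfV ler_pdivrMr ?normr_gt0// mul1r.
move=> x xq; pose delta : 'rV[R]_n.+1 := \row_k if unlift j k is Some i then x i else 0.
have [|t At] := lines delta.
  apply: le_trans (enorm_le_coord (r := r / n.+1%:R) _) _; last first.
    by rewrite mulrC divfK// pnatr_eq0.
  move=> k; rewrite mxE; case: unliftP => [i _|_]; last by rewrite normr0 divr_ge0.
  by have /andP[h1 h2] := xq i; rewrite ger0_norm.
exists (c + delta + t *: w) => // i.
by rewrite /P !mxE liftK unlift_none; field.
Qed.

(** * Convex bodies and their normals *)

Section convex_bodies.
Context {R : realType} {n : nat}.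
Local Notation d := n.+1.
Implicit Types (x y z e v w : 'rV[R]_d) (r q t : R) (E : set 'rV[R]_d).

Lemma convex_setP E : convex_set (E : set (convex_lmodType 'rV[R]_d)) ->
  forall x y t, E x -> E y -> 0 <= t <= 1 -> E ((1 - t) *: x + t *: y).
Proof.
move=> cE x y t Ex Ey /andP[t0 t1].
have /set_mem := cE y x (Itv01 t0 t1) (mem_set Ey) (mem_set Ex).
by rewrite addrC; apply.
Qed.

Context (E : set 'rV[R]_d).
Context (cE : forall x y t, E x -> E y -> 0 <= t <= 1 -> E ((1 - t) *: x + t *: y)).

(** As [x] lies only in the closure, it is replaced by a point [x'] of [E] so close that the [z']
    solving [p = (1 - t) x' + t z'] stays in the ball around [z]. *)
Lemma interior_segment x z r t : closure E x -> eball z r `<=` E -> 0 < t <= 1 ->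
  eball ((1 - t) *: x + t *: z) (t * r) `<=` interior E.
Proof.
move=> /closure_eball Ex zE /andP[t0 t1]; apply: eball_interior => p; rewrite /eball/= => pr.
set c := (1 - t) *: x + t *: z in pr.
have gap : 0 < t * r - enorm (c - p) by rewrite subr_gt0.
have [x' Ex' xx'] := Ex _ gap.
pose z' := t^-1 *: (p - (1 - t) *: x').
have -> : p = (1 - t) *: x' + t *: z'.
  by apply/rowP => i; rewrite !mxE; field; lra.
apply: cE => //; last by rewrite ltW.
apply: zE; rewrite /eball/= -(ltr_pM2l t0).
have -> : t * enorm (z - z') = enorm ((c - p) - (1 - t) *: (x - x')).
  rewrite -{1}(ger0_norm (ltW t0)) -enormZ; congr enorm.
  by apply/rowP => i; rewrite !mxE; field; lra.
apply: le_lt_trans (enormD _ _) _; rewrite enormN enormZ ger0_norm ?subr_ge0//.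
have : (1 - t) * enorm (x - x') <= enorm (x - x').
  by rewrite ler_piMl ?enorm_ge0//; lra.
lra.
Qed.

Lemma interior_segment_pt x z t : closure E x -> interior E z -> 0 < t <= 1 ->
  (interior E) ((1 - t) *: x + t *: z).
Proof.
move=> Ex /interior_eball[r r0 zE] t01; apply: (interior_segment Ex zE t01).
by apply: eball_center; rewrite mulr_gt0//; case/andP: t01.
Qed.

End convex_bodies.

Section frontier_crossing.
Context {R : realType} {n : nat}.
Local Notation d := n.+1.
Implicit Types (x y z e v w p q : 'rV[R]_d) (r t : R) (E : set 'rV[R]_d).

(** The crossing parameter is the supremum of those with an interior point: were the point there
    interior, the parameter could be increased, or equals 1 and the point is [q]. *)
Lemma frontier_crossing E p q : interior E p -> ~ (interior E) q ->
  exists2 t, 0 <= t <= 1 & (frontier E) (p + t *: (q - p)).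
Proof.
move=> Ep nEq; pose y t := p + t *: (q - p).
pose S := [set t | 0 <= t <= 1 /\ (interior E) (y t)].
have yd t t' : enorm (y t - y t') = `|t - t'| * enorm (q - p).
  by rewrite -enormZ; congr enorm; apply/rowP => i; rewrite !mxE; ring.
have S0 : S 0 by split; [lra|rewrite /y scale0r addr0].
have Sub : ubound S 1 by move=> t [/andP[]].
have hS : has_sup S by split; [exists 0|exists 1].
have t0 : 0 <= sup S by apply: ub_le_sup => //; exists 1.
have t1 : sup S <= 1 by apply: ge_sup => //; exists 0.
have Q0 : 0 < enorm (q - p) + 1 by rewrite ltr_pwDr ?enorm_ge0.
have small r t t' : `|t - t'| < r / (enorm (q - p) + 1) -> enorm (y t - y t') < r.
  rewrite ltr_pdivlMr// yd; apply: le_lt_trans; apply: ler_wpM2l => //.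
  by rewrite lerDl.
exists (sup S); first by rewrite t0.
split.
  apply/closure_eball => r r0.
  have r0' : 0 < r / (enorm (q - p) + 1) by rewrite divr_gt0.
  have [t St tr] := sup_adherent r0' hS.
  have tS : t <= sup S by apply: ub_le_sup => //; exists 1.
  exists (y t); first by case: St => _; exact: interior_subset.
  by apply: small; rewrite ger0_norm ?subr_ge0// ltrBlDr -ltrBlDl.
move=> yE; have [t1'|nt1] := eqVneq (sup S) 1.
  by apply: nEq; move: yE; rewrite t1' scale1r addrC subrK.
have lt1 : sup S < 1 by rewrite lt_neqAle nt1.
have [r r0 rE] := (nbhs_eball _ _).1 (nbhs_interior yE).
pose u := r / (enorm (q - p) + 1).
have u0 : 0 < u by rewrite divr_gt0.
pose t' := Num.min 1 (sup S + u / 2).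
have tt' : sup S < t' by rewrite lt_min lt1 /=; lra.
have St' : S t'.
  split; first by rewrite ge_min lexx andbT; lra.
  apply: rE; apply: small; rewrite ler0_norm ?subr_le0 1?ltW// opprB ltrBlDl -/u.
  by rewrite gt_min; apply/orP; right; lra.
by have := ub_le_sup (ex_intro _ 1 Sub) St'; rewrite leNgt tt'.
Qed.

End frontier_crossing.

(** * The chart normal supports the convex set *)

Section exterior_normal.
Context {R : realType} {n : nat}.
Local Notation d := n.+1.
Implicit Types (x y z v : 'rV[R]_d) (Q : 'M[R]_d) (u : 'rV[R]_n -> R).

Lemma dot_mulmx_tr v y Q : dot y (v *m Q^T) = dot (y *m Q) v.
Proof.
have E (a b : 'rV[R]_d) : dot a b = (a *m b^T) 0 0.
  by rewrite mxE; apply: eq_bigr => i _; rewrite mxE.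
by rewrite !E trmx_mul trmxK mulmxA.
Qed.

Lemma dot_col' (a b : 'rV[R]_d) :
  dot a b = dot (col' ord_max a) (col' ord_max b) + a 0 ord_max * b 0 ord_max.
Proof.
rewrite /dot (bigD1_ord ord_max)//= addrC; congr (_ + _).
by apply: eq_bigr => i _; rewrite !mxE.
Qed.

Let graph_dir (g : 'rV[R]_n) : 'rV[R]_d :=
  \row_j if unlift ord_max j is Some i then - g 0 i else 1.

Let dot_graph_dir (a : 'rV[R]_d) g :
  dot a (graph_dir g) = a 0 ord_max - dot (col' ord_max a) g.
Proof.
rewrite dot_col' !mxE unlift_none mulr1 addrC -dotNr; congr (_ + _).
by apply: eq_bigr => i _; rewrite !mxE liftK.
Qed.

Let slope_gt0 (g : 'rV[R]_n) : 0 < Num.sqrt (1 + dot g g).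
Proof. by rewrite sqrtr_gt0 ltr_wpDr ?dot_ge0. Qed.

Lemma graph_normal_unit Q u x : Q *m Q^T = 1%:M -> enorm (graph_normal Q u x) = 1.
Proof.
move=> QQ; rewrite /graph_normal; move: (gradient _ _) => g; rewrite -/(graph_dir g).
rewrite enormZ gtr0_norm ?invr_gt0//.
suff -> : enorm (graph_dir g *m Q^T) = Num.sqrt (1 + dot g g).
  by rewrite mulVf// gt_eqF.
rewrite /enorm dot_mulmx_tr -mulmxA (mulmx1C QQ) mulmx1 dot_graph_dir.
congr (Num.sqrt _); rewrite !mxE unlift_none; congr (_ + _).
by rewrite -dotNl; apply: eq_bigr => i _; rewrite !mxE liftK opprK.
Qed.

Lemma derive_gradient u (b v : 'rV[R]_n) : differentiable u b ->
  'D_v u b = dot v (gradient u b).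
Proof.
move=> du; rewrite deriveE// {1}(row_sum_delta v) linear_sum.
by apply: eq_bigr => i _; rewrite linearZ /= mxE deriveE.
Qed.

(** If [z - x] pointed strictly above the tangent plane, differentiability would put [x + t (z - x)]
    above the graph for small [t], although these points are interior. *)
Lemma graph_normal_support E x r Q u z : graph_chart E x r Q u ->
  differentiable u (base_coord Q x) -> (frontier E) x ->
  (forall t, 0 < t <= 1 -> (interior E) (x + t *: (z - x))) ->
  dot (z - x) (graph_normal Q u x) <= 0.
Proof.
move=> [r0 QQ chart] du Fx seg.
have hx := (chart x (eball_center x r0)).2.1 Fx.
rewrite /graph_normal; set b := base_coord Q x in du hx *; set g := gradient u b.
rewrite -/(graph_dir g) dotZr pmulr_rle0 ?invr_gt0//.
rewrite dot_mulmx_tr dot_graph_dir subr_le0 -derive_gradient//.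
set v := z - x; set hv := (v *m Q) 0 ord_max; set bv := col' _ _.
rewrite leNgt; apply/negP => Dlt.
have db : derivable u b bv by exact: diff_derivable.
have [e /= e0 De] := (nbhs_ballP _ _).1 (cvgr_lt _ db _ Dlt).
(* The three bounds keep the point on the segment, in the range of the difference quotient estimate,
   and in the chart. *)
pose t := Num.min 1 (Num.min (e / 2) (r / (2 * (enorm v + 1)))).
have v1 : 0 < 2 * (enorm v + 1) by rewrite mulr_gt0// ltr_pwDr ?enorm_ge0.
have t0 : 0 < t by rewrite !lt_min ltr01 !divr_gt0.
have te : t < e by rewrite !gt_min; apply/orP; right; apply/orP; left; lra.
have tr : t <= r / (2 * (enorm v + 1)) by rewrite !ge_min lexx !orbT.
have t1 : t <= 1 by rewrite ge_min lexx.
have inball : eball x r (x + t *: v).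
  rewrite /eball/= opprD addrA subrr add0r enormN enormZ gtr0_norm//.
  apply: (@lt_le_trans _ _ (t * (2 * (enorm v + 1)))).
    by rewrite ltr_pM2l//; have := enorm_ge0 v; lra.
  by rewrite -ler_pdivlMr.
have /((chart _ inball).1.1) : (interior E) (x + t *: v) by apply: seg; rewrite t0.
have -> : height_coord Q (x + t *: v) = height_coord Q x + t * hv.
  by rewrite /height_coord mulmxDl -scalemxAl mxE [X in _ + X]mxE.
have -> : base_coord Q (x + t *: v) = t *: bv + b.
  by rewrite /base_coord mulmxDl -scalemxAl addrC; apply/rowP => i; rewrite !mxE.
rewrite hx -ltrBrDl => lt1.
have /De : ball (0 : R) e t by rewrite -ball_normE /= sub0r normrN gtr0_norm.
have tn0 : t != 0 by rewrite gt_eqF.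
move=> /(_ tn0) /=; rewrite /GRing.scale/= => lt2.
have := lt_trans lt1 (_ : u (t *: bv + b) - u b < t * hv).
by rewrite ltxx => /(_ _)/negP; apply; rewrite // -ltr_pdivrMl.
Qed.

Lemma exterior_normal_support E alpha x :
  (forall x y t, E x -> E y -> 0 <= t <= 1 -> E ((1 - t) *: x + t *: y)) ->
  interior E !=set0 -> C1_holder_boundary alpha E -> (frontier E) x ->
  enorm (exterior_normal E x) = 1 /\
  forall z, closure E z -> dot (z - x) (exterior_normal E x) <= 0.
Proof.
move=> cE [c Ec] bE Fx.
have /(xgetPex 0) : exists v, [set v | exists r Q u,
    [/\ graph_chart E x r Q u, differentiable u (base_coord Q x) &
        v = graph_normal Q u x]] v.
  have [r [Q [u [ch [du _]]]]] := bE x Fx.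
  exists (graph_normal Q u x), r, Q, u; split => //.
  by apply: du; apply: eball_center; case: ch.
rewrite -/(exterior_normal E x) => -[r [Q [u [ch du ->]]]].
have Qu := ch; case: Qu => r0 QQ _.
split; first exact: graph_normal_unit.
set v := graph_normal Q u x.
have intE z : (interior E) z -> dot (z - x) v <= 0.
  move=> Ez; apply: (graph_normal_support ch du Fx) => t t01.
  have := interior_segment_pt cE Fx.1 Ez t01.
  by congr (interior E _); apply/rowP => i; rewrite !mxE; ring.
move=> z Ez; rewrite leNgt; apply/negP => zv.
have cv := intE _ Ec.
(* Chosen so that the interior point [(1 - t) z + t c] retains half of the positive value at [z],
   against [intE]. *)
pose t := dot (z - x) v / (2 * (dot (z - x) v - dot (c - x) v)).
have D0 : 0 < 2 * (dot (z - x) v - dot (c - x) v) by lra.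
have t01 : 0 < t <= 1 by rewrite divr_gt0//= ler_pdivrMr//; lra.
have := intE _ (interior_segment_pt cE Ez Ec t01).
have -> : (1 - t) *: z + t *: c - x = (1 - t) *: (z - x) + t *: (c - x).
  by apply/rowP => i; rewrite !mxE; ring.
rewrite !(dotDl, dotZl).
have tE : t * (2 * (dot (z - x) v - dot (c - x) v)) = dot (z - x) v.
  by rewrite /t divfK// gt_eqF.
rewrite !dotE in zv cv tE *; nra.
Qed.

End exterior_normal.

(** * Inscribed ball and diameter in terms of the ratio of radii *)

Section radii.
Context {R : realType} {n : nat}.
Local Notation d := n.+1.
Implicit Types (x y z : 'rV[R]_d) (r : R) (E : set 'rV[R]_d).

Lemma closure_in_eball E x r : E `<=` eball x r ->
  forall y, closure E y -> enorm (x - y) <= r.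
Proof.
move=> Er y /closure_eball yE; apply/ler_addgt0Pr => e e0.
have [z Ez yz] := yE e e0; have := Er z Ez; rewrite /eball/= => xz.
by have := enorm_distD z x y; rewrite (enormB z y); lra.
Qed.

Lemma bounded_enorm E : bounded_set E -> exists K, forall y, E y -> enorm y <= K.
Proof.
move=> [M [_ EM]]; exists (d%:R * (M + 1)) => y Ey.
apply: enorm_le_coord => i; apply: le_trans (EM (M + 1) _ y Ey); last by rewrite ltrDl.
have := @le_bigmax _ _ _ 0 (fun ij : 'I_1 * 'I_d => `|y ij.1 ij.2|) (0, i).
by rewrite -mx_normrE.
Qed.

Lemma eball_two_pts x r : 0 < r -> exists y, eball x r y /\ enorm (x - y) = r / 2.
Proof.
move=> r0; pose v : 'rV[R]_d := delta_mx 0 0.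
have v1 : enorm v = 1.
  rewrite /enorm /dot (bigD1 0)//= big1 => [|i /negbTE i0].
    by rewrite !mxE !eqxx addr0 mulr1 sqrtr1.
  by rewrite !mxE i0 mulr0.
exists (x + (r / 2) *: v).
have -> : enorm (x - (x + (r / 2) *: v)) = r / 2.
  by rewrite opprD addrA subrr add0r enormN enormZ v1 mulr1 gtr0_norm//; lra.
split => //; rewrite /eball/= opprD addrA subrr add0r enormN enormZ v1 mulr1.
by rewrite gtr0_norm//; lra.
Qed.

(** Neither radius need be attained: [rho] exceeds half the inner radius, and [E] lies in a ball
    whose radius exceeds the outer one by less than the inner one. This gives one factor 2; doubling
    the radius to bound distances gives the other. *)
Lemma inner_outer_balls E ratio : bounded_set E -> interior E !=set0 ->
  outer_radius E / inner_radius E = ratio ->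
  exists rho x0, [/\ 0 < rho, eball x0 rho `<=` E, rho <= 2 * diam E &
    forall y z, closure E y -> closure E z ->
      enorm (y - z) <= 4 * (`|ratio| + 1) * rho].
Proof.
move=> /bounded_enorm[K EK] [c /interior_eball[r0 r0_gt0 cE]] rat.
have Edist y z : E y -> E z -> enorm (y - z) <= 2 * K.
  move=> /EK yK /EK zK; apply: le_trans (enormD _ _) _; rewrite enormN; lra.
set ri := inner_radius E in rat; set S := [set r | 0 < r /\ exists x, eball x r `<=` E].
have diamE y z : E y -> E z -> enorm (y - z) <= diam E.
  move=> Ey Ez; apply: ub_le_sup; last by exists y => //; exists z.
  by exists (2 * K) => _ [y' Ey' [z' Ez' <-]]; exact: Edist.
have Srad r x : 0 < r -> eball x r `<=` E -> r <= 2 * diam E /\ r <= 4 * K.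
  move=> r_gt0 xE; have [y [xy xyr]] := eball_two_pts x r_gt0.
  have Ex : E x by apply: xE; exact: eball_center.
  by have := diamE _ _ Ex (xE _ xy); have := Edist _ _ Ex (xE _ xy); rewrite xyr; lra.
have Sr0 : S r0 by split => //; exists c.
have hS : has_sup S.
  by split; [exists r0|exists (4 * K) => r [r_gt0 [x xE]]; have [] := Srad r x r_gt0 xE].
have ri0 : 0 < ri by apply: lt_le_trans r0_gt0 _; apply: ub_le_sup => //; case: hS.
have ri2 : 0 < ri / 2 by lra.
have [rho [rho0 [x0 x0E]] rhori] := sup_adherent ri2 hS.
have {}rhori : ri < 2 * rho by move: rhori; rewrite -/(inner_radius E) -/ri; lra.
exists rho, x0; split => //; first by have [] := Srad rho x0 rho0 x0E.
set S' := [set r | 0 < r /\ exists x, E `<=` eball x r].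
have hS' : has_inf S'.
  split; last by exists 0 => r [/ltW].
  exists (`|K| + 1); split; first by rewrite ltr_wpDl.
  exists 0 => y /EK yK; rewrite /eball/= sub0r enormN.
  by apply: le_lt_trans yK _; have := ler_norm K; lra.
have [R0 [_ [c0 c0E]] R0lt] := inf_adherent ri0 hS'.
have ror : outer_radius E = ratio * ri by rewrite -rat divfK// gt_eqF.
have R0rho : R0 <= 2 * ((`|ratio| + 1) * rho).
  move: R0lt; rewrite -/(outer_radius E) ror => R0lt.
  have k1 : ratio * ri <= `|ratio| * ri by rewrite ler_pM2r// ler_norm.
  have k2 : (`|ratio| + 1) * ri <= (`|ratio| + 1) * (2 * rho).
    by rewrite ler_pM2l ?ltr_wpDl// ltW.
  lra.
move=> y z /(closure_in_eball c0E) yo /(closure_in_eball c0E) zo.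
by have := enorm_distD c0 y z; rewrite (enormB y c0); lra.
Qed.

End radii.

(** * Deep pieces of the boundary of large measure *)

Section boundary_measure.
Context {R : realType} {n : nat}.
Local Notation d := n.+1.
Implicit Types (y z v : 'rV[R]_d) (t : R).
Local Notation H := (@hausdorff_outer R n d).

(* A convex body E with a boundary point x, a supporting unit normal e at x, an
   inscribed ball of radius rho and all of E within distance M rho of x. *)
Record pointed_body (E : set 'rV[R]_d) (x x0 e : 'rV[R]_d) (rho M : R) : Prop :=
  PointedBody {
    body_convex : forall y z t, E y -> E z -> 0 <= t <= 1 -> E ((1 - t) *: y + t *: z);
    body_closure : closure E x;
    body_radius_gt0 : 0 < rho;
    body_ball : eball x0 rho `<=` E;
    body_bound : forall y, closure E y -> enorm (x - y) <= M * rho;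
    body_normal_unit : enorm e = 1;
    body_normal : forall y, closure E y -> dot (y - x) e <= 0;
    body_support : forall y, (frontier E) y -> exists2 v, enorm v = 1 &
      forall z, closure E z -> dot (z - y) v <= 0 }.

(** The point [x0 + s v] lies in the open ball for every [s < rho], hence below the hyperplane; [s]
    tends to [rho]. *)
Lemma support_eball (E : set 'rV[R]_d) x0 rho p v : 0 < rho -> eball x0 rho `<=` E ->
  enorm v = 1 -> (forall z, E z -> dot (z - p) v <= 0) -> dot (x0 - p) v <= - rho.
Proof.
move=> rho0 x0E v1 pv; apply/ler_addgt0Pr => eps eps0.
pose s := Num.max 0 (rho - eps).
have s0 : 0 <= s by rewrite le_max lexx.
have srho : s < rho by rewrite gt_max rho0 /=; lra.
have seps : rho - eps <= s by rewrite le_max lexx orbT.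
have /pv : E (x0 + s *: v).
  by apply: x0E; rewrite /eball/= opprD addrA subrr add0r enormN enormZ v1 mulr1 ger0_norm.
have -> : x0 + s *: v - p = (x0 - p) + s *: v by rewrite addrAC.
by rewrite dotDl dotZl -enorm_sqr v1 expr1n mulr1; lra.
Qed.

Definition far_frontier (E : set 'rV[R]_d) x e rho M : set 'rV[R]_d :=
  frontier E `&` [set y | enorm (x - y) <= M * rho /\ dot (y - x) e <= - (rho / 2)].

(** Lines in direction [-e] start in the disc of radius [rho / 2] about [x0], at depth at least
    [rho / 2]; moving along [-e] until the boundary is met only increases the depth. *)
Lemma hausdorff_far_frontier E x x0 e rho M : pointed_body E x x0 e rho M ->
  ((line_constant R n * (rho / 2) ^+ n)%:E <= H (far_frontier E x e rho M))%E.
Proof.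
move=> [cE Ex rho0 x0E EM e1 Ee _].
have EcE z : E z -> closure E z by exact: subset_closure.
have x0_int y : enorm (x0 - y) < rho -> (interior E) y.
  exact: (eball_interior x0E).
have x0e : dot (x0 - x) e <= - rho.
  by apply: (support_eball rho0 x0E) => // z /EcE; exact: Ee.
have e0 : e != 0 by apply/eqP => e0; move: e1; rewrite e0 enorm0 => /esym/eqP; rewrite oner_eq0.
apply: (hausdorff_lines (c := x0) e0); first by lra.
move=> delta dr; set p := x0 + delta.
have Ep : (interior E) p.
  apply: x0_int; rewrite /p opprD addrA subrr add0r enormN; lra.
have M0 : 0 <= M * rho by apply: le_trans (EM _ Ex); exact: enorm_ge0.
(* Longer than any segment in the closure of [E], all of which is within [M * rho] of [x]. *)
pose T := 2 * (M * rho) + 1.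
have nEq : ~ (interior E) (p - T *: e).
  move=> /interior_subset/EcE/EM Eq.
  have := EM _ (EcE _ (interior_subset Ep)).
  have := enorm_distD x p (p - T *: e).
  have -> : enorm (p - (p - T *: e)) = `|T|.
    by rewrite opprB addrCA subrr addr0 enormZ e1 mulr1.
  by have := ler_norm T; rewrite {1}/T (enormB p x); lra.
have [s /andP[s0 s1] Fs] := frontier_crossing Ep nEq.
clear Ep nEq; exists (- (s * T)).
have yE : p + - (s * T) *: e = p + s *: (p - T *: e - p).
  by apply/rowP => i; rewrite !mxE; ring.
rewrite yE; split; first exact: Fs.
split; first by apply: EM; exact: Fs.1.
have -> : p + s *: (p - T *: e - p) - x = (x0 - x) + delta - (s * T) *: e.
  by rewrite /p; apply/rowP => i; rewrite !mxE; ring.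
rewrite dotBl dotDl dotZl -enorm_sqr e1 expr1n mulr1.
have := dot_le_enorm delta e; rewrite e1 mulr1.
have T0 : 0 <= T by rewrite /T; lra.
have sT0 := mulr_ge0 s0 T0.
by have := x0e; lra.
Qed.

(** The segment from [x0] to [y] meets the boundary at a point with supporting normal [v]. As [x0]
    is below that hyperplane, [y] is not, so the hyperplane may be translated to [y]. *)
Lemma exterior_separation E x x0 e rho M y :
  pointed_body E x x0 e rho M -> ~ (interior E) y -> exists2 v, enorm v = 1 &
  forall z, closure E z -> dot (z - y) v <= 0.
Proof.
move=> [cE Ex rho0 x0E EM e1 Ee supp] nEy.
have EcE z' : E z' -> closure E z' by exact: subset_closure.
have Ex0 : (interior E) x0 by apply: (eball_interior x0E); exact: eball_center.
have [s /andP[s0 s1] Fs] := frontier_crossing Ex0 nEy.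
have [v v1 Ev] := supp _ Fs; exists v => // z Ez.
have sn0 : s != 0.
  by apply/eqP => s_0; move: Fs; rewrite s_0 scale0r addr0 => -[_]; apply.
have sp : 0 < s by rewrite lt_def sn0.
have := Ev z Ez; have := Ev x0 (EcE _ (interior_subset Ex0)).
have -> : x0 - (x0 + s *: (y - x0)) = (- s) *: (y - x0).
  by rewrite opprD addrA subrr add0r scaleNr.
have -> : z - (x0 + s *: (y - x0)) = (z - y) + (1 - s) *: (y - x0).
  by apply/rowP => i; rewrite !mxE; ring.
rewrite (dotDl (z - y)) !dotZl mulNr oppr_le0 pmulr_rge0// => h1 h2.
have : 0 <= (1 - s) * dot (y - x0) v by rewrite mulr_ge0// subr_ge0.
lra.
Qed.

Definition near_frontier (E : set 'rV[R]_d) x e M q m : set 'rV[R]_d :=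
  frontier E `&` [set y | q <= enorm (x - y) <= (5 * M + 4) * q /\
                          dot (y - x) e <= - m].

(* Let v be a normal separating y1 from E and w = x - x0.  The vector
   k = v / (v . w) - e / (e . w) is orthogonal to w, and a boundary point y with
   (y - y1) . k >= 0 lies at least as deep below the hyperplane e as y1 does.
   Lines parallel to w based on a disc pushed far in the direction k therefore
   meet the boundary at points of depth m at distance of order q from x. *)
Lemma hausdorff_near_frontier E x x0 e rho M q m y1 :
  pointed_body E x x0 e rho M -> 0 < q -> 5 * q <= rho -> 0 < m ->
  ~ (interior E) y1 -> enorm (x - y1) < q -> dot (y1 - x) e <= - m ->
  ((line_constant R n * q ^+ n)%:E <= H (near_frontier E x e M q m))%E.
Proof.
move=> B q0 qrho m0 nEy1 y1q y1m.
have [v v1 Ev] := exterior_separation B nEy1.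
have [cE Ex rho0 x0E EM e1 Ee _] := B.
have EcE z : E z -> closure E z by exact: subset_closure.
have x0e : dot (x0 - x) e <= - rho.
  by apply: (support_eball rho0 x0E) => // z /EcE; exact: Ee.
pose w := x - x0; pose a := y1 - x.
have aq : enorm a < q by rewrite enormB.
have av : 0 <= dot a v.
  by have := Ev x Ex; rewrite -oppr_ge0 -dotNl opprB.
have ave : dot a v <= q.
  by have := dot_le_enorm a v; rewrite v1 mulr1; lra.
have we : rho <= dot w e by have := x0e; rewrite /w !dotBl; lra.
have wv : 0 < dot w v.
  have := support_eball rho0 x0E v1 (fun z Ez => Ev z (EcE _ Ez)).
  by move: ave; rewrite /w /a !dotBl; lra.
have we0 : 0 < dot w e by lra.
pose k := (dot w v)^-1 *: v - (dot w e)^-1 *: e.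
have kw : dot k w = 0.
  rewrite /k dotBl !dotZl (dotC v) (dotC e) !mulVf ?subrr// gt_eqF//.
have ak : 0 < dot a k.
  rewrite /k dotBr !dotZr.
  have h1 : 0 <= (dot w v)^-1 * dot a v by rewrite mulr_ge0// invr_ge0 ltW.
  have h2 : 0 < (dot w e)^-1 * - dot a e by rewrite mulr_gt0 ?invr_gt0//; rewrite /a; lra.
  lra.
have kn : 0 < enorm k.
  have := dot_le_enorm a k; rewrite lt_def enorm_ge0 andbT => h.
  by apply/eqP => k0; move: h; rewrite k0 mulr0; lra.
pose kh := (enorm k)^-1 *: k.
have kh1 : enorm kh = 1 by rewrite /kh enormZ ger0_norm ?invr_ge0 ?enorm_ge0// mulVf// gt_eqF.
have akh : 0 <= dot a kh by rewrite /kh dotZr mulr_ge0 ?invr_ge0 ?enorm_ge0// ltW.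
have khw : dot kh w = 0 by rewrite /kh dotZl kw mulr0.
have w0 : w != 0 by apply/eqP => w0; move: we0; rewrite w0 dot0l; lra.
have wM : enorm w <= M * rho.
  by apply: EM; apply: EcE; apply: x0E; exact: eball_center.
(* Of the shift [2 q] along [kh], at most [q] is undone by the disc of radius [q]; the remaining [q]
   gives both the lower bound on the distance and the sign of [(y - y1) . k]. *)
apply: (hausdorff_lines (c := x + a + (2 * q) *: kh) w0); first exact: ltW.
move=> delta dq; set beta := a + (2 * q) *: kh + delta.
have betaq : enorm beta < 4 * q.
  have := enormD (a + (2 * q) *: kh) delta; have := enormD a ((2 * q) *: kh).
  by rewrite enormZ kh1 gtr0_norm; rewrite -/beta; lra.
(* Since [|beta| < 4 q], this [lam] puts one end of the segment in the cone over the inscribed ball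
   and the other beyond the hyperplane at [x]. The factor [5 M + 4] comes from
   [|beta| + lam |w|]. *)
pose lam := 5 * q / rho.
have lam0 : 0 < lam by rewrite divr_gt0// mulr_gt0.
have lam1 : lam <= 1 by rewrite ler_pdivrMr// mul1r.
have lamrho : lam * rho = 5 * q by rewrite divfK// gt_eqF.
have Ep : (interior E) (x + beta - lam *: w).
  apply: (interior_segment cE Ex x0E (t := lam)); first by rewrite lam0.
  rewrite /eball/= lamrho.
  have -> : (1 - lam) *: x + lam *: x0 - (x + beta - lam *: w) = - beta.
    by rewrite /w; apply/rowP => i; rewrite !mxE; ring.
  by rewrite enormN; lra.
have nEq : ~ (interior E) (x + beta + lam *: w).
  move=> /interior_subset/EcE/Ee.
  have -> : x + beta + lam *: w - x = beta + lam *: w.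
    by apply/rowP => i; rewrite !mxE; ring.
  rewrite dotDl dotZl.
  have h1 : lam * rho <= lam * dot w e by rewrite ler_pM2l.
  have h2 := dot_le_enorm (- beta) e; rewrite enormN e1 mulr1 dotNl in h2.
  by rewrite lamrho in h1; lra.
have [s /andP[s0 s1] Fs] := frontier_crossing Ep nEq.
clear Ep nEq nEy1; pose t := - lam + 2 * lam * s.
exists t; set y := (X in near_frontier _ _ _ _ _ _ X).
have yE : y = x + beta - lam *: w + s *: (x + beta + lam *: w - (x + beta - lam *: w)).
  by rewrite /y /t /beta; apply/rowP => i; rewrite !mxE; ring.
have Fy : (frontier E) y by rewrite yE.
pose b := beta + t *: w.
have yx : y - x = b by rewrite /y /b /beta; apply/rowP => i; rewrite !mxE; ring.
have xy : enorm (x - y) = enorm b by rewrite enormB yx.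
have bkh : q <= dot b kh - dot a kh.
  have kk : dot kh kh = 1 by rewrite -enorm_sqr kh1 expr1n.
  have -> : dot b kh = dot a kh + 2 * q + dot delta kh.
    rewrite /b /beta (dotDl (a + _ + _)) (dotDl (a + _)) (dotDl a) (dotZl (2 * q)) (dotZl t).
    by rewrite kk (dotC w) khw; ring.
  have := dot_le_enorm (- delta) kh; rewrite enormN kh1 mulr1 dotNl; lra.
split; first exact: Fy.
rewrite /= xy yx; split.
  apply/andP; split.
    by have := dot_le_enorm b kh; rewrite kh1 mulr1; lra.
  apply: le_trans (enormD _ _) _; rewrite enormZ.
  have tl : `|t| <= lam.
    rewrite ler_norml /t.
    have : 0 <= lam * s by rewrite mulr_ge0// ltW.
    have : lam * s <= lam by rewrite ler_piMr// ltW.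
    by rewrite -mulrA; lra.
  have : `|t| * enorm w <= lam * (M * rho).
    by apply: ler_pM => //; exact: enorm_ge0.
  by rewrite mulrCA lamrho; lra.
have bv : dot b v <= dot a v.
  have := Ev y Fy.1; have -> : y - y1 = b - a by rewrite -yx /a opprB addrA subrK.
  by rewrite dotBl; lra.
have bk : 0 <= dot b k - dot a k.
  have khk z : dot z k = enorm k * dot z kh.
    by rewrite /kh dotZr mulrA mulfV ?mul1r// gt_eqF.
  by rewrite !khk -mulrBr mulr_ge0 ?enorm_ge0//; lra.
have : dot b e <= dot a e.
  rewrite -(ler_pM2l (_ : 0 < (dot w e)^-1)) ?invr_gt0//.
  have := bk; rewrite /k !dotBr !dotZr.
  have : (dot w v)^-1 * dot b v <= (dot w v)^-1 * dot a v.
    by rewrite ler_pM2l// invr_gt0.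
  lra.
by move: y1m; rewrite -/a; lra.
Qed.

End boundary_measure.

(** * Integral estimates *)

Section geometric_bounds.
Context {R : realType}.
Implicit Types (r b theta : R).

Lemma geometric_sum_le r N : 0 <= r < 1 -> \sum_(k < N) r ^+ k <= (1 - r)^-1.
Proof.
move=> /andP[r0 r1]; have r1' : 0 < 1 - r by rewrite subr_gt0.
rewrite -[leRHS]mulr1 ler_pdivlMl// -opprB mulNr -subrX1 opprB.
by rewrite gerBl exprn_ge0.
Qed.

(* Weighted AM-GM for b and 1, from 1 + t <= exp t. *)
Lemma powR_le_affine b theta : 0 < b -> 0 <= theta <= 1 ->
  b `^ theta <= 1 - theta * (1 - b).
Proof.
move=> b0 /andP[t0 t1]; pose A := 1 - theta * (1 - b).
have A0 : 0 < A.
  rewrite /A; have [->|tn1] := eqVneq theta 1; first by lra.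
  have : theta < 1 by rewrite lt_neqAle tn1.
  by have : 0 <= theta * b := mulr_ge0 t0 (ltW b0); lra.
have tangent z : 0 < z -> A * (1 + (ln z - ln A)) <= z.
  move=> z0; have := expR_ge1Dx (ln z - ln A).
  rewrite expRB !lnK// ler_pdivlMr ?expR_gt0//.
  by rewrite mulrC.
have := tangent b b0; have := tangent 1 ltr01; rewrite ln1 => h1 h2.
have : theta * ln b <= ln A.
  rewrite -(ler_pM2l A0).
  have k1 : theta * (A * (1 + (ln b - ln A))) <= theta * b by rewrite ler_wpM2l.
  have k2 : (1 - theta) * (A * (1 + (0 - ln A))) <= (1 - theta) * 1.
    by rewrite ler_wpM2l// subr_ge0.
  have : A = 1 - theta * (1 - b) by [].
  by move: k1 k2; set a := A; lra.
by rewrite /powR gt_eqF// -ler_expR lnK.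
Qed.

(** Controls geometric series of ratio [b^theta]: [theta = s] produces the factor [1/s] at infinity,
    [theta = 1 - s] the factor [1/(1-s)] near [x]. *)
Lemma inv_one_sub_powR_le b theta : 0 < b <= 2^-1 -> 0 < theta <= 1 ->
  0 <= b `^ theta < 1 /\ (1 - b `^ theta)^-1 <= 2 / theta.
Proof.
move=> /andP[b0 b2] /andP[t0 t1].
have h := powR_le_affine b0 (_ : 0 <= theta <= 1).
have {}h : b `^ theta <= 1 - theta * (1 - b) by apply: h; rewrite (ltW t0).
have tb : theta * 2^-1 <= theta * (1 - b) by rewrite ler_pM2l//; lra.
split; first by rewrite powR_ge0/=; lra.
rewrite -[leRHS]invrK lef_pV2 ?posrE ?invr_gt0 ?divr_gt0//; last by lra.
by rewrite invf_div; lra.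
Qed.

(** The quadratic polynomial of [key] in [t] is nonnegative; its minimiser [S / B] gives the claim,
    and [B = 0] forces [S = 0] by a suitable [t]. *)
Lemma weighted_cauchy_schwarz (I : finType) (u g q : I -> R) :
  (forall i, 0 < g i) -> (forall i, 0 < q i) ->
  (\sum_i u i * g i) ^+ 2 <= (\sum_i u i ^+ 2 * g i / q i) * (\sum_i g i * q i).
Proof.
move=> g0 q0; set S := \sum_i _; set A := (X in X * _); set B := (X in _ * X).
have g0' i := ltW (g0 i); have q0' i := ltW (q0 i).
have gq0 i : 0 <= g i / q i by apply: divr_ge0; [exact: g0'|exact: q0'].
have A0 : 0 <= A.
  by apply: sumr_ge0 => i _; rewrite -mulrA mulr_ge0 ?sqr_ge0//; exact: gq0.
have B0 : 0 <= B.
  by apply: sumr_ge0 => i _; apply: mulr_ge0; [exact: g0'|exact: q0'].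
have key t : 0 <= A + t ^+ 2 * B - 2 * t * S.
  rewrite /A /B /S !mulr_sumr -big_split -sumrB.
  apply: sumr_ge0 => i _ /=.
  have -> : u i ^+ 2 * g i / q i + t ^+ 2 * (g i * q i) - 2 * t * (u i * g i) =
      g i / q i * (u i - t * q i) ^+ 2.
    by field; rewrite gt_eqF.
  by rewrite mulr_ge0 ?sqr_ge0//; exact: gq0.
have [B_0|Bn0] := eqVneq B 0.
  have [S_0|Sn0] := eqVneq S 0; first by rewrite S_0 expr0n mulr_ge0.
  have := key ((A + 1) / (2 * S)); rewrite B_0 mulr0 addr0.
  have -> : 2 * ((A + 1) / (2 * S)) * S = A + 1 by field.
  lra.
have Bp : 0 < B by rewrite lt_def Bn0.
have := key (S / B).
have -> : A + (S / B) ^+ 2 * B - 2 * (S / B) * S = (A * B - S ^+ 2) / B by field.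
by rewrite pmulr_lge0 ?invr_gt0// subr_ge0.
Qed.

End geometric_bounds.

(** The step function with values [c i] on the disjoint [A i] lies below [f]. Measurability is asked
    of the sets alone, which suits the boundary integrand. *)
Lemma ge0_integral_lower_sum d (T : measurableType d) (R : realType)
    (mu : {measure set T -> \bar R}) (D : set T) (f : T -> R) N
    (A : 'I_N -> set T) (c : 'I_N -> R) :
  (forall y, D y -> 0 <= f y) -> (forall i, measurable (A i)) ->
  (forall i, A i `<=` D) -> (forall i j, i != j -> A i `&` A j = set0) ->
  (forall i, 0 <= c i) -> (forall i y, A i y -> c i <= f y) ->
  (\sum_(i < N) (c i)%:E * mu (A i) <= \int[mu]_(y in D) (f y)%:E)%E.
Proof.
move=> f0 mA AD dA c0 cf.
have -> : (\sum_(i < N) (c i)%:E * mu (A i) =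
    \int[mu]_y (\sum_(i < N) (c i * \1_(A i) y)%:E))%E.
  rewrite ge0_integral_sum//; last 2 first.
  - move=> i; apply/measurable_EFinP; exact: measurable_funM.
  - by move=> i y _; rewrite lee_fin mulr_ge0.
  apply: eq_bigr => i _; under eq_integral do rewrite EFinM.
  rewrite ge0_integralZl_EFin//; last first.
    by apply/measurable_EFinP; exact: (measurable_indic (mA i)).
  by rewrite (integral_indic _ measurableT (mA i)) setIT.
rewrite [leRHS]integral_mkcond; apply: ge0_le_integral_any => y.
  by apply: sume_ge0 => i _; rewrite lee_fin mulr_ge0.
rewrite sumEFin.
have [[i Ai]|nA] := pselect (exists i, A i y).
  rewrite patchE mem_set; last exact: AD Ai.
  rewrite (bigD1 i)//= big1 ?addr0.
    by rewrite indicE mem_set// mulr1 lee_fin; exact: cf.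
  move=> j ji; rewrite indicE memNset ?mulr0// => Aj.
  by have := dA _ _ ji; rewrite -subset0 => /(_ y); apply.
rewrite big1 => [|i _]; last by rewrite indicE memNset ?mulr0// => Ai; apply: nA; exists i.
by rewrite patchE; case: ifPn => // /set_mem /f0; rewrite lee_fin.
Qed.

Lemma exprn_powR (R : realType) (a s : R) k : 0 <= a -> (a `^ s) ^+ k = (a ^+ k) `^ s.
Proof.
move=> a0; rewrite -(powR_mulrn k (powR_ge0 a s)) -(powR_mulrn k a0).
by rewrite -!powRrM mulrC.
Qed.

(** * The singular kernel and its tail *)

Section riesz_kernel.
Context {R : realType} {n : nat}.
Local Notation d := n.+1.
Implicit Types (x y : 'rV[R]_d) (s q : R) (A U E : set 'rV[R]_d).
Local Notation outer := (@lebesgue_outer R d).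
Local Notation T := (caratheodory_type outer).
Local Notation mu := (lebesgue_Rd R d).

Definition kern s x y : R := (enorm (x - y) `^ (d%:R + s))^-1.

Lemma kern_ge0 s x y : 0 <= kern s x y.
Proof. by rewrite invr_ge0 powR_ge0. Qed.

Lemma kern_reflect s x y : kern s x (reflect_pt x y) = kern s x y.
Proof.
rewrite /kern /reflect_pt; congr ((_ `^ _)^-1).
by rewrite -enormN; congr enorm; apply/rowP => i; rewrite !mxE; ring.
Qed.

Lemma measurable_kern s x A : measurable_fun (A : set T) (fun y : T => (kern s x y)%:E).
Proof.
apply: measurable_funTS; apply/measurable_EFinP.
have -> : kern s x = (fun r : R => r `^ (- (d%:R + s))) \o (fun y => enorm (x - y)).
  by apply/funext => y; rewrite /kern /= powRN.
apply: measurableT_comp; first exact: measurable_powR.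
exact/continuous_lebesgue_measurable/enorm_dist_continuous.
Qed.

Lemma inv_powR_natD s q : 0 < q -> (q `^ (d%:R + s))^-1 = q ^- d * (q `^ s)^-1.
Proof.
move=> q0; rewrite powRD; last by rewrite (gt_eqF q0) implybT.
by rewrite powR_mulrn ?(ltW q0)// invfM.
Qed.

Lemma kern_le s x y q : 0 < s -> 0 < q -> q <= enorm (x - y) ->
  kern s x y <= (q `^ (d%:R + s))^-1.
Proof.
move=> s0 q0 qy; have y0 := lt_le_trans q0 qy.
rewrite lef_pV2 ?posrE ?powR_gt0//.
have p0 : 0 <= d%:R + s by rewrite addr_ge0// ltW.
by apply: (ge0_ler_powR p0) => //; rewrite nnegrE ltW.
Qed.

Lemma measurable_eball x q : measurable (eball x q : set T).
Proof. exact/open_lebesgue_measurable/eball_open. Qed.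

Lemma kern_integral_le s x A q : 0 < s -> 0 < q -> measurable (A : set T) ->
  (forall y, A y -> q <= enorm (x - y)) ->
  (\int[mu]_(y in A) (kern s x y)%:E <= ((q `^ (d%:R + s))^-1)%:E * outer A)%E.
Proof.
move=> s0 q0 mA Aq; rewrite -[X in (_ <= X)%E](integral_cst mu mA).
apply: ge0_le_integral => //.
- by move=> y _; rewrite lee_fin kern_ge0.
- exact: measurable_kern.
- by move=> y Ay; rewrite lee_fin; apply: kern_le => //; exact: Aq.
Qed.

(** Dyadic shells: shell [k] lies in a cube of side [4 r k] and the kernel there is at most
    [(r k)^-(d+s)], which leaves [4^d] and a geometric series of ratio [2^-s]. *)
Lemma kern_integral_far s x q : 0 < s < 1 -> 0 < q ->
  (\int[mu]_(y in ~` eball x q) (kern s x y)%:E <=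
    (4 ^+ d * (2 / s) * (q `^ s)^-1)%:E)%E.
Proof.
move=> /andP[s0 s1] q0; pose r k := q * 2 ^+ k.
have r0 k : 0 < r k by rewrite /r mulr_gt0 ?exprn_gt0.
have rS k : r k.+1 = 2 * r k by rewrite /r exprS; ring.
pose F k : set 'rV[R]_d := eball x (r k.+1) `\` eball x (r k).
have mF k : measurable (F k : set T) by apply: measurableD; exact: measurable_eball.
have eballr y k j : (k <= j)%N -> eball x (r k) y -> eball x (r j) y.
  move=> kj; rewrite /eball/= => /lt_le_trans; apply.
  by rewrite /r ler_pM2l// ler_weXn2l// ler1n.
have FE : ~` eball x q = \bigcup_k F k.
  have r_0 : r 0%N = q by rewrite /r expr0 mulr1.
  apply/seteqP; split => [y nqy|y [k _ [_ nky]] qy]; last first.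
    by apply: nky; apply: (eballr y 0%N) => //; rewrite r_0.
  have [N Ny] : exists N, eball x (r N) y.
    exists (Num.trunc (enorm (x - y) / q)).+1; rewrite /eball/= /r mulrC -ltr_pdivrMr//.
    apply: lt_trans (truncnS_gt _) _.
    by rewrite -natrX ltr_nat; exact: ltn_expl.
  elim: N Ny => [|N IH] Ny; first by case: nqy; rewrite -r_0.
  have [/IH//|Ny'] := pselect (eball x (r N) y).
  by exists N.
have tF : trivIset setT F.
  apply/trivIsetP => i j _ _; wlog ij : i j / (i < j)%N.
    move=> h; rewrite neq_ltn => /orP[ij|ji]; first by apply: h => //; rewrite ltn_eqF.
    by rewrite setIC; apply: h => //; rewrite ltn_eqF.
  move=> _; apply/seteqP; split => // y [[iy _] [_ jy]].
  by apply: jy; apply: eballr iy.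
rewrite FE ge0_integral_bigcup; last 4 first.
- exact: mF.
- exact: measurable_kern.
- by move=> y _; rewrite lee_fin kern_ge0.
- exact: tF.
have half01 : 0 < (2^-1 : R) <= 2^-1 by rewrite lexx andbT invr_gt0.
have s01 : 0 < s <= 1 by rewrite s0 ltW.
have [h2 h3] := inv_one_sub_powR_le half01 s01.
pose rho : R := 2^-1 `^ s.
have FK k : (\int[mu]_(y in F k) (kern s x y)%:E <=
    (4 ^+ d * (q `^ s)^-1 * rho ^+ k)%:E)%E.
  apply: le_trans (kern_integral_le s0 (r0 k) (mF k) _) _.
    by move=> y [_ /negP]; rewrite -leNgt.
  have ro : (outer (F k) <= ((2 * r k.+1) ^+ d)%:E)%E.
    apply: le_trans (lebesgue_outer_ball x (r0 k.+1)).
    by apply: le_outer_measure => y [].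
  apply: le_trans (lee_wpmul2l _ ro) _; first by rewrite lee_fin invr_ge0 powR_ge0.
  rewrite -EFinM lee_fin inv_powR_natD// rS.
  have -> : 2 * (2 * r k) = 4 * r k by ring.
  rewrite exprMn_comm; last exact: mulrC.
  have rkn : r k ^+ d != 0 by rewrite expf_neq0// gt_eqF.
  have -> : r k ^- d * (r k `^ s)^-1 * (4 ^+ d * r k ^+ d) = 4 ^+ d * (r k `^ s)^-1.
    by field; rewrite rkn gt_eqF ?powR_gt0.
  rewrite -mulrA ler_pM2l ?exprn_gt0// /r powRM ?exprn_ge0 ?(ltW q0)//.
  rewrite invfM ler_pM2l ?invr_gt0 ?powR_gt0//.
  rewrite -[leLHS]mulr1 ler_pdivrMl ?powR_gt0 ?exprn_gt0//.
  rewrite /rho exprn_powR// -powRM ?exprn_ge0// -exprMn_comm; last exact: mulrC.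
  by rewrite mulfV// expr1n powR1.
apply: lime_le.
  by apply: is_cvg_nneseries => k _ _; apply: integral_ge0 => y _; rewrite lee_fin kern_ge0.
apply: nearW => N; apply: le_trans (lee_sum _ (fun k _ => FK k)) _.
rewrite sumEFin lee_fin -mulr_sumr [leRHS]mulrAC ler_pM2l; last first.
  by rewrite mulr_gt0 ?exprn_gt0// invr_gt0 powR_gt0.
rewrite big_mkord; apply: le_trans (geometric_sum_le N h2) h3.
Qed.

End riesz_kernel.

(** * Cancellation by reflection and decomposition into shells *)

Section curvature_integral.
Context {R : realType} {n : nat}.
Local Notation d := n.+1.
Implicit Types (x y : 'rV[R]_d) (s q : R) (A U E : set 'rV[R]_d).
Local Notation outer := (@lebesgue_outer R d).
Local Notation T := (caratheodory_type outer).
Local Notation mu := (lebesgue_Rd R d).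

Lemma reflect_eball x q : reflect_pt x @^-1` eball x q = eball x q.
Proof.
apply/seteqP; split => y; rewrite /preimage /eball/=;
  by have -> : enorm (x - reflect_pt x y) = enorm (x - y)
    by rewrite -enormN; congr enorm; apply/rowP => i; rewrite !mxE; ring.
Qed.

(** Positive and negative parts are estimated separately: the first vanishes on the interior and is
    at most the kernel elsewhere, the second equals the kernel on the interior. Points of [E]
    outside the interior are thus counted with the sign [+]. *)
Let signed_kern_integral_le s x E D :
  (\int[mu]_(y in D) (signed_indicator E y / enorm (x - y) `^ (d%:R + s))%:E <=
   \int[mu]_(y in D `\` interior E) (kern s x y)%:E -
   \int[mu]_(y in D `&` interior E) (kern s x y)%:E)%E.
Proof.
set U := interior E; set K := fun y : T => (kern s x y)%:E.
have K0 y : (0 <= K y)%E by rewrite lee_fin kern_ge0.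
pose g y : \bar R := (signed_indicator E y / enorm (x - y) `^ (d%:R + s))%:E.
have le1 : (\int[mu]_(y in D) (g ^\+ y) <= \int[mu]_(y in D `\` U) K y)%E.
  rewrite integral_mkcond [leRHS]integral_mkcond; apply: ge0_le_integral_any => y.
    by apply: erestrict_ge0.
  rewrite !patchE; case: ifPn => [yD|yD]; last first.
    by rewrite memNset// => -[yD' _]; rewrite mem_set in yD.
  rewrite funeposE /g /signed_indicator; have [yU|yU] := pselect (U y).
    rewrite mem_set; last exact: interior_subset.
    rewrite memNset; last by move=> [].
    by rewrite -EFin_max lee_fin ge_max lexx andbT mulN1r oppr_le0 kern_ge0.
  have -> : (y \in D `\` U) = true by apply/mem_set; split => //; exact: set_mem.
  rewrite -EFin_max lee_fin ge_max kern_ge0 andbT -/(kern s x y).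
  case: ifP => _; rewrite ?mulN1r ?mul1r//.
  by rewrite (le_trans _ (kern_ge0 s x y))// oppr_le0 kern_ge0.
have le2 : (\int[mu]_(y in D `&` U) K y <= \int[mu]_(y in D) (g ^\- y))%E.
  rewrite integral_mkcond [leRHS]integral_mkcond; apply: ge0_le_integral_any => y.
    by apply: erestrict_ge0.
  rewrite !patchE; case: ifPn => [/set_mem[yD yU]|yD]; last first.
    by case: ifPn => // _; exact: funeneg_ge0.
  have -> : (y \in D) = true by exact/mem_set.
  rewrite funenegE /g /signed_indicator mem_set; last exact: interior_subset.
  by rewrite -EFinN -EFin_max lee_fin le_max mulN1r opprK lexx.
rewrite integralE; exact: leeB le1 le2.
Qed.

(* The reflection at x maps U = interior E into the complement of E, up to the
   boundary: the contributions of U and of its image cancel. *)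
Lemma curvature_integral_le s x E eps : 0 < s < 1 -> 0 < eps ->
  (forall y, (interior E) y -> ~ (interior E) (reflect_pt x y)) ->
  (\int[mu]_(y in ~` eball x eps)
     (signed_indicator E y / enorm (x - y) `^ (d%:R + s))%:E <=
   \int[mu]_(y in ~` eball x eps `\` (interior E `|` reflect_pt x @^-1` interior E))
     (kern s x y)%:E)%E.
Proof.
move=> s01 eps0 disj; set D := ~` eball x eps; set U := interior E.
set U' := reflect_pt x @^-1` U; set K := fun y : T => (kern s x y)%:E.
have UU' : U `&` U' = set0.
  by apply/seteqP; split => y // [Uy]; exact: disj.
clear disj; have K0 y : (0 <= K y)%E by rewrite lee_fin kern_ge0.
have mD : measurable (D : set T) by exact/measurableC/measurable_eball.
have mU : measurable (U : set T) by exact/open_lebesgue_measurable/open_interior.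
have mU' : measurable (U' : set T).
  by rewrite -[U']setTI; apply: measurable_reflect.
have mK A : measurable_fun (A : set T) K by exact: measurable_kern.
have mDU : measurable (D `&` U : set T) := measurableI _ _ mD mU.
have mDU' : measurable (D `&` U' : set T) := measurableI _ _ mD mU'.
have mW : measurable (D `\` (U `|` U') : set T) := measurableD mD (measurableU _ _ mU mU').
have cancel (a b : \bar R) : a \is a fin_num -> (a + b - a <= b)%E.
  by move=> afin; rewrite addeAC subee// add0e.
have fin : (\int[mu]_(y in D `&` U) K y \is a fin_num)%E.
  rewrite ge0_fin_numE; last by apply: integral_ge0 => y _; exact: K0.
  apply: le_lt_trans (ltry (4 ^+ d * (2 / s) * (eps `^ s)^-1)).
  apply: le_trans (kern_integral_far x s01 eps0).
  apply: ge0_subset_integral; [exact: mDU|exact: mD|exact: mK| |].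
    by move=> y _; exact: K0.
  by move=> y [].
have sym : (\int[mu]_(y in D `&` U) K y = \int[mu]_(y in D `&` U') K y)%E.
  rewrite -(@integral_reflect _ _ x (D `&` U)); [|exact: mDU|exact: mK|exact: K0].
  have -> : reflect_pt x @^-1` (D `&` U) = D `&` U'.
    by rewrite preimage_setI /D -preimage_setC reflect_eball.
  by apply: eq_integral => y _; rewrite /K kern_reflect.
have split : (\int[mu]_(y in D `\` U) K y = \int[mu]_(y in D `&` U') K y +
    \int[mu]_(y in D `\` (U `|` U')) K y)%E.
  rewrite -ge0_integral_setU; last 5 first.
  - exact: mDU'.
  - exact: mW.
  - exact: mK.
  - by move=> y _; exact: K0.
  - by apply/disj_setPS => y [[_ U'y] [_ nUy]]; apply: nUy; right; exact: U'y.
  - congr (integral _ _ _); apply/seteqP; split => y.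
      move=> [Dy nUy]; have [U'y|nU'y] := pselect (U' y).
        left; split; [exact: Dy|exact: U'y].
      right; split; first exact: Dy.
      case; [exact: nUy|exact: nU'y].
    move=> [[Dy U'y]|[Dy nUU'y]]; (split; first exact: Dy) => Uy.
      have UUy : (U `&` U') y := conj Uy U'y; rewrite UU' in UUy; exact: UUy.
    exact: nUU'y (or_introl Uy).
apply: le_trans (signed_kern_integral_le s x E D) _; rewrite -/U.
rewrite split -sym; exact: cancel fin.
Qed.

(** In shell [k] the kernel is bounded by its value at the inner radius [q k.+1] and the volume by
    that within the outer radius [q k]; everything beyond [q 0] is left to the tail. *)
Lemma kern_integral_shells s x A (q : nat -> R) (a : nat -> R) (eps : R) N :
  0 < s < 1 -> measurable (A : set T) -> (forall k, 0 < q k) ->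
  A `<=` ~` eball x eps -> q N <= eps ->
  (forall k, (outer (A `&` eball x (q k)) <= (a k)%:E)%E) ->
  (\int[mu]_(y in A) (kern s x y)%:E <=
    (\sum_(k < N) (q k.+1 `^ (d%:R + s))^-1 * a k +
     4 ^+ d * (2 / s) * (q 0%N `^ s)^-1)%:E)%E.
Proof.
move=> /[dup] s01 /andP[s0 s1] mA q0 Aeps qN Aa.
have mK B : measurable_fun (B : set T) (fun y : T => (kern s x y)%:E).
  exact: measurable_kern.
have mB r : measurable (eball x r : set T) by exact: measurable_eball.
have step k : (\int[mu]_(y in A `\` eball x (q k.+1)) (kern s x y)%:E <=
    ((q k.+1 `^ (d%:R + s))^-1 * a k)%:E +
    \int[mu]_(y in A `\` eball x (q k)) (kern s x y)%:E)%E.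
  have m1 : measurable ((A `&` eball x (q k)) `\` eball x (q k.+1) : set T).
    exact: measurableD (measurableI _ _ mA (mB _)) (mB _).
  have m2 : measurable (A `\` eball x (q k) : set T) := measurableD mA (mB _).
  apply: (@le_trans _ _ (\int[mu]_(y in ((A `&` eball x (q k)) `\` eball x (q k.+1)) `|`
      (A `\` eball x (q k))) (kern s x y)%:E)%E).
    apply: ge0_subset_integral; [exact: measurableD mA (mB _)|exact: measurableU _ _ m1 m2|exact: mK| |].
      by move=> y _; rewrite lee_fin kern_ge0.
    by move=> y [Ay nqy]; have [qy|] := pselect (eball x (q k) y); [left|right].
  rewrite ge0_integral_setU; last 5 first.
  - exact: m1.
  - exact: m2.
  - exact: mK.
  - by move=> y _; rewrite lee_fin kern_ge0.
  - by apply/disj_setPS => y [[[_ h] _] [_]]; apply.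
  apply: leeD2r; apply: le_trans (kern_integral_le s0 (q0 k.+1) m1 _) _.
    by move=> y [_ /negP]; rewrite -leNgt.
  rewrite EFinM; apply: lee_wpmul2l; first by rewrite lee_fin invr_ge0 powR_ge0.
  by apply: le_trans (Aa k); apply: le_outer_measure => y [].
have far : (\int[mu]_(y in A `\` eball x (q 0%N)) (kern s x y)%:E <=
    (4 ^+ d * (2 / s) * (q 0%N `^ s)^-1)%:E)%E.
  apply: le_trans (kern_integral_far x s01 (q0 0%N)).
  apply: ge0_subset_integral; [exact: measurableD mA (mB _)|exact: measurableC (mB _)|exact: mK| |].
    by move=> y _; rewrite lee_fin kern_ge0.
  by move=> y [].
have -> : A = A `\` eball x (q N).
  apply/seteqP; split => [y Ay|y []//]; split => // qy; apply: (Aeps _ Ay).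
  exact: lt_le_trans qy qN.
elim: N {qN} => [|N IH]; first by rewrite big_ord0 add0r.
apply: le_trans (step N) _; apply: le_trans (leeD2l _ IH) _.
by rewrite -EFinD lee_fin big_ord_recr /=; lra.
Qed.

End curvature_integral.

(** * Lower bound for the boundary integrand; depth of the complement *)

Section frontier_estimates.
Context {R : realType} {n : nat}.
Local Notation d := n.+1.
Implicit Types (x y z e v : 'rV[R]_d) (s q r m M rho : R) (E : set 'rV[R]_d).
Local Notation H := (@hausdorff_outer R n d).

Lemma closed_frontier E : closed (frontier E).
Proof.
rewrite /frontier setDE; apply: closedI; first exact: closed_closure.
exact/open_closedC/open_interior.
Qed.

Let closed_enorm_le x r : closed [set y | enorm (x - y) <= r].
Proof.
exact: (continuous_closedP (fun y => enorm (x - y))).1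
  (@enorm_dist_continuous R n x) [set t | t <= r] (@closed_le R r).
Qed.

Let closed_enorm_ge x r : closed [set y | r <= enorm (x - y)].
Proof.
exact: (continuous_closedP (fun y => enorm (x - y))).1
  (@enorm_dist_continuous R n x) [set t | r <= t] (@closed_ge R r).
Qed.

Let closed_dot_le x e r : closed [set y | dot (y - x) e <= r].
Proof.
exact: (continuous_closedP (fun y => dot (y - x) e)).1
  (@dot_dist_continuous R n x e) [set t | t <= r] (@closed_le R r).
Qed.

Lemma closed_far_frontier E x e rho M : closed (far_frontier E x e rho M).
Proof.
apply: closedI; first exact: closed_frontier.
exact: closedI (@closed_enorm_le x (M * rho)) (@closed_dot_le x e (- (rho / 2))).
Qed.

Lemma closed_near_frontier E x e M q m : closed (near_frontier E x e M q m).
Proof.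
apply: closedI; first exact: closed_frontier.
have -> : [set y | q <= enorm (x - y) <= (5 * M + 4) * q /\ dot (y - x) e <= - m] =
    [set y | q <= enorm (x - y)] `&` [set y | enorm (x - y) <= (5 * M + 4) * q] `&`
    [set y | dot (y - x) e <= - m].
  by apply/seteqP; split => y /=; [move=> [/andP[? ?] ?]|move=> [[-> ->]]].
exact: closedI (closedI (@closed_enorm_ge x q) (@closed_enorm_le x ((5 * M + 4) * q)))
  (@closed_dot_le x e (- m)).
Qed.

(* Since y - x has a nonpositive component along e and a nonnegative one along
   v, it sees the difference v - e, whose square is 2 (1 - v . e). *)
Lemma one_sub_dot_ge x y e v : enorm e = 1 -> enorm v = 1 ->
  dot (y - x) e <= 0 -> dot (x - y) v <= 0 ->
  dot (y - x) e ^+ 2 <= 2 * enorm (x - y) ^+ 2 * (1 - dot v e).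
Proof.
move=> e1 v1 ye xv.
have ve : enorm (v - e) ^+ 2 = 2 * (1 - dot v e).
  by rewrite enorm_sqr !dotE -!enorm_sqr e1 v1 (dotC e v); ring.
have h : - dot (y - x) e <= enorm (x - y) * enorm (v - e).
  rewrite (enormB x y); apply: le_trans (dot_le_enorm (y - x) (v - e)).
  by move: xv; rewrite dotBr -(opprB y x) dotNl; lra.
rewrite mulrAC -ve mulrC -exprMn_comm; last exact: mulrC.
rewrite -sqrrN ler_pXn2r// nnegrE; first by rewrite oppr_ge0.
by rewrite mulr_ge0 ?enorm_ge0.
Qed.

Definition frontier_integrand s E x y : R :=
  (1 - dot (exterior_normal E y) (exterior_normal E x)) /
  enorm (x - y) `^ (d%:R + s).

Lemma frontier_integrand_ge s E x y e r m : 0 < s ->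
  e = exterior_normal E x -> enorm e = 1 -> enorm (exterior_normal E y) = 1 ->
  dot (y - x) e <= - m -> dot (x - y) (exterior_normal E y) <= 0 ->
  0 <= m -> 0 < enorm (x - y) <= r ->
  m ^+ 2 / (2 * r ^+ 2) * (r `^ (d%:R + s))^-1 <= frontier_integrand s E x y.
Proof.
move=> s0 eE e1 v1 ym xv m0 /andP[y0 yr].
have r0 := lt_le_trans y0 yr.
have ye : dot (y - x) e <= 0 by lra.
have := one_sub_dot_ge e1 v1 ye xv; rewrite /frontier_integrand -eE => h.
have g0 : 0 <= 1 - dot (exterior_normal E y) e.
  by have := dot_le_enorm (exterior_normal E y) e; rewrite e1 v1 mulr1; lra.
apply: ler_pM.
- by rewrite divr_ge0 ?sqr_ge0// mulr_ge0 ?sqr_ge0.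
- by rewrite invr_ge0 powR_ge0.
- rewrite ler_pdivrMr ?mulr_gt0 ?exprn_gt0//.
  apply: (@le_trans _ _ (dot (y - x) e ^+ 2)).
    by rewrite -[leRHS]sqrrN ler_pXn2r ?nnegrE//; lra.
  apply: le_trans h _; rewrite mulrC; apply: ler_wpM2l => //.
  by rewrite ler_pM2l// ler_pXn2r ?nnegrE ?enorm_ge0 ?(ltW r0).
- rewrite lef_pV2 ?posrE ?powR_gt0//.
  have p0 : 0 <= d%:R + s by rewrite addr_ge0// ltW.
  by apply: (ge0_ler_powR p0) => //; rewrite nnegrE ltW.
Qed.

(* How far the complement of E reaches below the supporting hyperplane within
   distance q of x; 0 is adjoined to make the set nonempty. *)
Definition depth E x e q : R := sup [set t | t = 0 \/
  exists y, [/\ ~ (interior E) y, enorm (x - y) < q & t = - dot (y - x) e]].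

Let depth_has_sup E x e q : enorm e = 1 -> 0 < q ->
  has_sup [set t | t = 0 \/
    exists y, [/\ ~ (interior E) y, enorm (x - y) < q & t = - dot (y - x) e]].
Proof.
move=> e1 q0; split; first by exists 0; left.
exists q => t [->|[y [_ yq ->]]]; first exact: ltW.
rewrite -dotNl; apply: le_trans (dot_le_enorm _ _) _.
by rewrite enormN e1 mulr1 enormB ltW.
Qed.

Lemma depth_ge0 E x e q : enorm e = 1 -> 0 < q -> 0 <= depth E x e q.
Proof.
by move=> e1 q0; apply: ub_le_sup; [case: (depth_has_sup E x e1 q0)|left].
Qed.

(** Both [y] and its reflection lie outside the interior, so the one-sided bound [depth] applies to
    [y - x] and to its opposite. *)
Lemma depth_slab E x e q : enorm e = 1 -> 0 < q ->
  (eball x q `\` (interior E `|` reflect_pt x @^-1` interior E)) `<=`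
  slab x e q (depth E x e q).
Proof.
move=> e1 q0 y [yq /not_orP[nUy nUy']]; split => //.
have ub z : ~ (interior E) z -> enorm (x - z) < q -> - dot (z - x) e <= depth E x e q.
  move=> nUz zq; apply: ub_le_sup; first by case: (depth_has_sup E x e1 q0).
  by right; exists z.
have := ub y nUy yq; have := ub (reflect_pt x y) nUy'.
have -> : x - reflect_pt x y = y - x.
  by rewrite /reflect_pt; apply/rowP => i; rewrite !mxE; ring.
have -> : reflect_pt x y - x = - (y - x).
  by rewrite /reflect_pt; apply/rowP => i; rewrite !mxE; ring.
rewrite dotNl opprK enormB => /(_ yq); rewrite ler_norml => h1 h2.
by apply/andP; split; lra.
Qed.

(** Half of the supremum is always reached. Positivity excludes the adjoined value 0, which has no
    witness. *)
Lemma depth_attained E x e q : enorm e = 1 -> 0 < q -> 0 < depth E x e q ->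
  exists y, [/\ ~ (interior E) y, enorm (x - y) < q &
    dot (y - x) e <= - (depth E x e q / 2)].
Proof.
move=> e1 q0 t0; have t2 : 0 < depth E x e q / 2 by lra.
have [t St tlt] := sup_adherent t2 (depth_has_sup E x e1 q0).
have {}tlt : depth E x e q / 2 < t by move: tlt; rewrite -/(depth E x e q); lra.
case: St => [t_0|[y [nUy yq tE]]]; first by lra.
by exists y; split => //; lra.
Qed.

End frontier_estimates.

(** * Lower bounds for the boundary integral *)

Section integral_estimates.
Context {R : realType} {n : nat}.
Local Notation d := n.+1.
Implicit Types (x y z e v : 'rV[R]_d) (s r m M L rho : R) (E : set 'rV[R]_d) (q : nat -> R).
Local Notation H := (@hausdorff_outer R n d).
Local Notation frontier_integral s E x :=
  (\int[hausdorff R n d]_(y in frontier E) (frontier_integrand s E x y)%:E)%E.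

Definition supporting_normals E := forall y, (frontier E) y ->
  enorm (exterior_normal E y) = 1 /\
  forall z, closure E z -> dot (z - y) (exterior_normal E y) <= 0.

Lemma frontier_integrand_ge0 s E x y : supporting_normals E ->
  (frontier E) x -> (frontier E) y -> 0 <= frontier_integrand s E x y.
Proof.
move=> nu /nu[x1 _] /nu[y1 _].
apply: divr_ge0; last exact: powR_ge0.
rewrite subr_ge0 -y1; exact: dot_le_unit x1.
Qed.

Lemma frontier_integral_far s E x x0 rho M : 0 < s < 1 -> 1 <= M ->
  supporting_normals E -> (frontier E) x ->
  pointed_body E x x0 (exterior_normal E x) rho M ->
  ((line_constant R n / (2 ^+ n * (8 * M ^+ (n + 4))) * ((rho `^ s)^-1 / rho))%:E <=
    frontier_integral s E x)%E.
Proof.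
move=> /andP[s0 s1] M1 nu Fx; move eE : (exterior_normal E x) => e B.
have [_ _ rho0 _ _ e1 _ _] := B.
have M0 : 0 < M by lra.
pose G := far_frontier E x e rho M.
pose c := (rho / 2) ^+ 2 / (2 * (M * rho) ^+ 2) * ((M * rho) `^ (d%:R + s))^-1.
have c0 : 0 <= c.
  by rewrite /c mulr_ge0 ?invr_ge0 ?powR_ge0// divr_ge0 ?sqr_ge0// mulr_ge0 ?sqr_ge0.
have := @ge0_integral_lower_sum _ _ R (hausdorff R n d) (frontier E)
  (frontier_integrand s E x) 1 (fun=> G) (fun=> c).
rewrite big_ord1 => /(_ _ _ _ _ _ _) lower.
apply: (@le_trans _ _ (c%:E * H G)%E).
  apply: (@le_trans _ _ (c%:E * (line_constant R n * (rho / 2) ^+ n)%:E)%E); last first.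
    by apply: lee_wpmul2l; [rewrite lee_fin|exact: hausdorff_far_frontier B].
  rewrite -EFinM lee_fin /c inv_powR_natD ?mulr_gt0// powRM ?(ltW M0) ?(ltW rho0)//.
  (* Makes the constant independent of [s]: [M^(n+3+s) <= M^(n+4)]. *)
  have Ms : M `^ s <= M.
    by have := ler_powR M1 (ltW s1); rewrite powRr1 ?(ltW M0).
  have Ms0 : 0 < M `^ s by rewrite powR_gt0.
  have rs0 : 0 < rho `^ s by rewrite powR_gt0.
  set a := line_constant R n.
  have a0 : 0 < a := line_constant_gt0 R n.
  have -> : (rho / 2) ^+ 2 / (2 * (M * rho) ^+ 2) *
      ((M * rho) ^- n.+1 / (M `^ s * rho `^ s)) * (a * (rho / 2) ^+ n) =
      a / (2 ^+ n * (8 * (M ^+ (n + 3) * M `^ s))) * ((rho `^ s)^-1 / rho).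
    rewrite !expr_div_n !exprMn_comm; try exact: mulrC.
    rewrite !exprD !exprS; field.
    by rewrite !expf_neq0 ?(gt_eqF rho0) ?(gt_eqF rs0) ?(gt_eqF Ms0) ?(gt_eqF M0).
  rewrite ler_pM2r; last by rewrite divr_gt0// invr_gt0.
  rewrite ler_pM2l// lef_pV2 ?posrE ?mulr_gt0 ?exprn_gt0//.
  rewrite ler_pM2l ?exprn_gt0// ler_pM2l//.
  by rewrite [in leRHS]addnS exprSr ler_pM2l ?exprn_gt0.
apply: lower.
- by move=> y Fy; exact: frontier_integrand_ge0.
- by move=> _; exact/closed_hausdorff_measurable/closed_far_frontier.
- by move=> _ y [].
- by move=> i j; rewrite !ord1 eqxx.
- by [].
move=> _ y [Fy [yM ye]].
have [y1 yE] := nu y Fy.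
apply: (frontier_integrand_ge s0 (esym eE) e1 y1 ye); first exact: yE Fx.1.
  by rewrite divr_ge0// ltW.
rewrite yM andbT; have := dot_le_unit (x - y) e1.
by rewrite -(opprB y x) dotNl; clear nu B; lra.
Qed.

Lemma frontier_integral_near s E x x0 rho M L q N : 0 < s < 1 -> 1 <= M ->
  L = 5 * M + 5 -> (forall k, 0 < q k) -> (forall k, q k = L * q k.+1) ->
  5 * q 0%N <= rho -> supporting_normals E -> (frontier E) x ->
  pointed_body E x x0 (exterior_normal E x) rho M ->
  ((line_constant R n / (8 * L ^+ (n + 4)) *
     \sum_(k < N) (depth E x (exterior_normal E x) (q k) / q k) ^+ 2 *
       (q k `^ s)^-1 / q k)%:E <= frontier_integral s E x)%E.
Proof.
move=> /andP[s0 s1] M1 LE q0 qL q0rho nu Fx.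
move eE : (exterior_normal E x) => e B.
have [_ _ _ _ _ e1 _ _] := B.
have L0 : 0 < L by lra.
have L1 : 1 <= L by lra.
pose tau k := depth E x e (q k).
have tau0 k : 0 <= tau k by exact: depth_ge0.
have qrho k : 5 * q k <= rho.
  elim: k => // k; apply: le_trans; rewrite (qL k) ler_pM2l//.
  by rewrite ler_peMl// ltW.
have q_lt i j : (i < j)%N -> L * q j <= q i.
  elim: j => // j IH; rewrite ltnS leq_eqVlt => /predU1P[->|/IH]; first by rewrite -qL.
  by apply: le_trans; rewrite (qL j) ler_peMl ?mulr_ge0 ?(ltW L0) ?(ltW (q0 _)).
pose G (k : 'I_N) := near_frontier E x e M (q k) (tau k / 2).
pose c (k : 'I_N) :=
  (tau k / 2) ^+ 2 / (2 * (L * q k) ^+ 2) * ((L * q k) `^ (d%:R + s))^-1.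
have c0 k : 0 <= c k.
  by rewrite /c mulr_ge0 ?invr_ge0 ?powR_ge0// divr_ge0 ?sqr_ge0// mulr_ge0 ?sqr_ge0.
have lower := @ge0_integral_lower_sum _ _ R (hausdorff R n d) (frontier E)
  (frontier_integrand s E x) N G c.
apply: (@le_trans _ _ (\sum_(k < N) (c k)%:E * H (G k))%E).
  rewrite mulr_sumr -sumEFin; apply: lee_sum => k _; rewrite -/(tau k).
  have := tau0 k; rewrite le_eqVlt => /predU1P[t0|t0].
    rewrite -t0 mul0r expr0n !mul0r mulr0.
    by rewrite mule_ge0 ?lee_fin// hausdorff_outer_ge0.
  have [y1 [nUy1 y1q y1e]] := depth_attained e1 (q0 k) t0.
  have t2 : 0 < tau k / 2 by rewrite divr_gt0.
  have HG := hausdorff_near_frontier B (q0 k) (qrho k) t2 nUy1 y1q y1e.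
  clear nUy1.
  apply: (@le_trans _ _ ((c k)%:E * (line_constant R n * (q k) ^+ n)%:E)%E); last first.
    by apply: lee_wpmul2l; [rewrite lee_fin|exact: HG].
  clear HG y1q y1e.
  rewrite -EFinM lee_fin /c inv_powR_natD ?mulr_gt0// powRM ?(ltW L0) ?(ltW (q0 k))//.
  have Ls : L `^ s <= L.
    by have := ler_powR L1 (ltW s1); rewrite powRr1 ?(ltW L0).
  have Ls0 : 0 < L `^ s by rewrite powR_gt0.
  have qs0 : 0 < q k `^ s by rewrite powR_gt0.
  have := line_constant_gt0 R n; set a := line_constant R n => a0.
  have qk := q0 k.
  have -> : (tau k / 2) ^+ 2 / (2 * (L * q k) ^+ 2) *
      ((L * q k) ^- n.+1 / (L `^ s * q k `^ s)) * (a * q k ^+ n) =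
      a / (8 * (L ^+ (n + 3) * L `^ s)) * ((tau k / q k) ^+ 2 * (q k `^ s)^-1 / q k).
    rewrite !expr_div_n !exprMn_comm; try exact: mulrC.
    rewrite !exprD !exprS; field.
    by rewrite !expf_neq0 ?(gt_eqF qk) ?(gt_eqF qs0) ?(gt_eqF Ls0) ?(gt_eqF L0).
  apply: ler_wpM2r.
    by rewrite divr_ge0 ?(ltW qk)// mulr_ge0 ?sqr_ge0// invr_ge0 ltW.
  rewrite ler_pM2l// lef_pV2 ?posrE ?mulr_gt0 ?exprn_gt0//.
  rewrite ler_pM2l//.
  by rewrite [in leRHS]addnS exprSr ler_pM2l ?exprn_gt0.
apply: lower.
- by move=> y Fy; exact: frontier_integrand_ge0.
- by move=> i; exact/closed_hausdorff_measurable/closed_near_frontier.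
- by move=> i y [].
(* The step [L = 5 M + 5] exceeds the outer factor [5 M + 4] of [near_frontier], so the rings are
   disjoint. *)
- have sep (i j : 'I_N) : (i < j)%N -> G i `&` G j = set0.
    move=> ij; apply/seteqP; split => // y [[_ [/andP[iy _] _]] [_ [/andP[_ jy] _]]].
    have := q_lt _ _ ij; have := q0 j; rewrite LE.
    by have := le_trans iy jy; lra.
  move=> i j; rewrite neq_ltn => /orP[/sep//|/sep]; by rewrite setIC.
- exact: c0.
move=> k y [Fy [/andP[qy yL] ye]].
have [y1 yE] := nu y Fy.
apply: (frontier_integrand_ge s0 (esym eE) e1 y1 ye); first exact: yE Fx.1.
  by rewrite divr_ge0// tau0.
rewrite (lt_le_trans (q0 k) qy)/=; apply: le_trans yL _.
by rewrite ler_pM2r// LE; lra.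
Qed.

End integral_estimates.

(** The midpoint of [y] and its reflection is [x], which would then be interior. *)
Lemma reflect_interior {R : realType} {n : nat} (E : set 'rV[R]_n.+1) (x y : 'rV[R]_n.+1) :
  (forall y z t, E y -> E z -> 0 <= t <= 1 -> E ((1 - t) *: y + t *: z)) ->
  ~ (interior E) x -> (interior E) y -> ~ (interior E) (reflect_pt x y).
Proof.
move=> cE nEx Ey Ey'; apply: nEx.
have t01 : 0 < (2^-1 : R) <= 1 by lra.
have := interior_segment_pt cE (subset_closure (interior_subset Ey)) Ey' t01.
by congr (interior E _); apply/rowP => i; rewrite !mxE; field.
Qed.

(** * Upper bound for the curvature and conclusion *)

Section curvature_upper_bound.
Context {R : realType} {n : nat}.
Local Notation d := n.+1.
Implicit Types (x y z e v : 'rV[R]_d) (s r m M L rho : R) (E : set 'rV[R]_d) (q : nat -> R).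

Lemma curvature_integral_bound s E x e Cs L q eps N : 0 < s < 1 -> 0 <= Cs ->
  (forall x e (r t : R), enorm e = 1 -> 0 < r -> 0 <= t ->
    (@lebesgue_outer R d (slab x e r t) <= (Cs * t * r ^+ n)%:E)%E) ->
  (forall y z t, E y -> E z -> 0 <= t <= 1 -> E ((1 - t) *: y + t *: z)) ->
  ~ (interior E) x -> enorm e = 1 -> 1 <= L ->
  (forall k, 0 < q k) -> (forall k, q k = L * q k.+1) -> 0 < eps -> q N <= eps ->
  (\int[lebesgue_Rd R d]_(y in ~` eball x eps)
     (signed_indicator E y / enorm (x - y) `^ (d%:R + s))%:E <=
   (Cs * L ^+ (n + 2) * (\sum_(k < N) depth E x e (q k) / q k * (q k `^ s)^-1) +
    4 ^+ d * (2 / s) * (q 0%N `^ s)^-1)%:E)%E.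
Proof.
move=> s01 Cs0 slabC cE nEx e1 L1 q0 qL eps0 qN; have /andP[s0 s1] := s01.
apply: le_trans (curvature_integral_le s01 eps0 _) _.
  by move=> y; exact: reflect_interior cE nEx.
clear cE nEx.
pose tau k := depth E x e (q k).
have tau0 k : 0 <= tau k by exact: depth_ge0.
have mU : measurable ((interior E) : set (caratheodory_type (@lebesgue_outer R d))).
  exact/open_lebesgue_measurable/open_interior.
have mU' : measurable ((reflect_pt x @^-1` interior E) : set (caratheodory_type (@lebesgue_outer R d))).
  rewrite -[X in measurable X]setTI; exact: measurable_reflect measurableT _ mU.
set A := ~` eball x eps `\` _.
have mA : measurable (A : set (caratheodory_type (@lebesgue_outer R d))).
  exact: measurableD (measurableC (measurable_eball x eps)) (measurableU _ _ mU mU').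
apply: le_trans (kern_integral_shells (q := q) (a := fun k => Cs * tau k * q k ^+ n) (eps := eps)
   (N := N) s01 mA q0 _ qN _) _.
- by move=> y [].
- move=> k; apply: le_trans (slabC x e (q k) (tau k) e1 (q0 k) (tau0 k)).
  apply: le_outer_measure => y [[_ yW] yq]; apply: (depth_slab e1 (q0 k)).
  by split; [exact: yq|exact: yW].
rewrite lee_fin lerD2r mulr_sumr; apply: ler_sum => k _; rewrite -/(tau k).
have L0 : 0 < L by lra.
(* Passing from [q k.+1] to [q k] in the kernel costs [L^(n+1+s)], here bounded by [L^(n+2)]. *)
have Ls : L `^ s <= L by have := ler_powR L1 (ltW s1); rewrite powRr1 ?(ltW L0).
have Ls0 : 0 < L `^ s by rewrite powR_gt0.
have p0 := q0 k.+1; rewrite inv_powR_natD// (qL k); move: p0; set p := q k.+1 => p0.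
have ps0 : 0 < p `^ s by rewrite powR_gt0.
rewrite (powRM s (ltW L0) (ltW p0)).
have -> : p ^- d / p `^ s * (Cs * tau k * (L * p) ^+ n) =
    Cs * tau k * L ^+ n / (p * p `^ s).
  rewrite exprMn_comm; last exact: mulrC.
  rewrite !exprS; field.
  by rewrite ?expf_neq0 ?(gt_eqF p0) ?(gt_eqF ps0).
have -> : Cs * L ^+ (n + 2) * (tau k / (L * p) * (L `^ s * p `^ s)^-1) =
    Cs * tau k * L ^+ n / (p * p `^ s) * (L / L `^ s).
  rewrite !exprD !exprS; field.
  by rewrite ?expf_neq0 ?(gt_eqF p0) ?(gt_eqF ps0) ?(gt_eqF L0) ?(gt_eqF Ls0).
apply: ler_peMr; last by rewrite ler_pdivlMr// mul1r.
by rewrite divr_ge0 ?mulr_ge0 ?exprn_ge0 ?(ltW L0) ?(ltW p0) ?(ltW ps0) ?tau0.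
Qed.

Lemma sum_weights_le s rho L q N : 0 < s < 1 -> 2 <= L -> (forall k, 0 < q k) ->
  (forall k, q k = L * q k.+1) -> q 0%N <= rho ->
  \sum_(k < N) (q k `^ s)^-1 * q k <= 2 / (1 - s) * rho `^ (1 - s).
Proof.
move=> /andP[s0 s1] L2 q0 qL q0rho.
have L0 : 0 < L by lra.
have qE k : q k = q 0%N * L^-1 ^+ k.
  elim: k => [|k IH]; first by rewrite expr0 mulr1.
  by rewrite exprSr mulrA -IH (qL k); field; rewrite gt_eqF.
have b0 : 0 < L^-1 <= 2^-1 by rewrite invr_gt0 L0/= lef_pV2 ?posrE.
have t0 : 0 < 1 - s <= 1 by lra.
have [b1 b2] := inv_one_sub_powR_le b0 t0.
have term k : (q k `^ s)^-1 * q k = q 0%N `^ (1 - s) * (L^-1 `^ (1 - s)) ^+ k.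
  rewrite exprn_powR ?invr_ge0 ?(ltW L0)// -powRM ?exprn_ge0 ?invr_ge0 ?(ltW L0) ?(ltW (q0 0%N))//.
  rewrite -qE powRD ?(gt_eqF (q0 k)) ?implybT// powRr1 ?(ltW (q0 k))//.
  by rewrite powRN mulrC.
under eq_bigr do rewrite term.
rewrite -mulr_sumr mulrC; apply: ler_pM.
- by apply: sumr_ge0 => k _; rewrite exprn_ge0// powR_ge0.
- exact: powR_ge0.
- exact: le_trans (geometric_sum_le N b1) b2.
- have s1' : 0 <= 1 - s by lra.
  have rho0 := lt_le_trans (q0 0%N) q0rho.
  apply: (ge0_ler_powR s1') => //; rewrite nnegrE; exact: ltW.
Qed.

End curvature_upper_bound.

(** Bookkeeping of the powers of [s] and [1-s]. Here [S], [A], [B] are the three sums of the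
    Cauchy-Schwarz inequality, [G = rho^-s], [P = rho^(1-s)] and [I] is the boundary integral. In
    [h1], [(1-s)^2] meets the factor [2/(1-s)] of [B]; in [h2], [G^2 = (G / rho) P]. *)
Lemma curvature_real_bound (R : realType) (s C1 C2 c1 c2 S A B G rho I P : R) :
  0 < s < 1 -> 0 <= C1 -> 0 <= C2 -> 0 < c1 -> 0 < c2 -> 0 < rho -> 0 <= S -> 0 <= G ->
  S ^+ 2 <= A * B -> 0 <= A -> 0 <= B -> c1 * A <= I -> B <= 2 / (1 - s) * P ->
  c2 * (G / rho) <= I -> P = G * rho ->
  s * (1 - s) * (C1 * S + C2 * (G / s)) <=
    (C1 * Num.sqrt (2 / c1) + C2 * Num.sqrt c2^-1) * Num.sqrt ((1 - s) * (I * P)).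
Proof.
move=> /andP[s0 s1] C10 C20 c10 c20 rho0 S0 G0 SAB A0 B0 AI BP GI PE.
have t0 : 0 < 1 - s by lra.
have P0 : 0 <= P by rewrite PE mulr_ge0// ltW.
have I0 : 0 <= I by apply: le_trans AI; rewrite mulr_ge0// ltW.
set Z := Num.sqrt ((1 - s) * (I * P)).
have AI' : A <= I / c1 by rewrite ler_pdivlMr// mulrC.
have GI' : G / rho <= I / c2 by rewrite ler_pdivlMr// mulrC.
have le_sqrt a b : 0 <= a -> a ^+ 2 <= b -> a <= Num.sqrt b.
  by move=> a0 /ler_wsqrtr; rewrite sqrtr_sqr ger0_norm.
have h1 : (1 - s) * S <= Num.sqrt (2 / c1) * Z.
  rewrite -sqrtrM ?divr_ge0 ?(ltW c10)//; apply: le_sqrt.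
    by rewrite mulr_ge0 ?(ltW t0).
  have -> : 2 / c1 * ((1 - s) * (I * P)) = (1 - s) ^+ 2 * ((I / c1) * (2 / (1 - s) * P)).
    by field; rewrite ?(gt_eqF c10) ?(gt_eqF t0).
  rewrite exprMn_comm; last exact: mulrC.
  rewrite ler_pM2l ?exprn_gt0//; apply: le_trans SAB _; exact: ler_pM.
have h2 : (1 - s) * G <= Num.sqrt c2^-1 * Z.
  rewrite -sqrtrM ?invr_ge0 ?(ltW c20)//; apply: le_sqrt.
    by rewrite mulr_ge0 ?(ltW t0).
  have -> : c2^-1 * ((1 - s) * (I * P)) = (1 - s) * ((I / c2) * P) by field; rewrite gt_eqF.
  rewrite exprMn_comm; last exact: mulrC.
  rewrite expr2 -mulrA ler_pM2l//.
  apply: (@le_trans _ _ (G ^+ 2)); first by rewrite ler_piMl ?sqr_ge0//; lra.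
  have -> : G ^+ 2 = (G / rho) * P by rewrite PE; field; rewrite gt_eqF.
  exact: ler_wpM2r.
have -> : s * (1 - s) * (C1 * S + C2 * (G / s)) =
    C1 * (s * ((1 - s) * S)) + C2 * ((1 - s) * G) by field; rewrite gt_eqF.
rewrite [leRHS]mulrDl -!mulrA; apply: lerD; apply: ler_wpM2l => //.
by apply: le_trans h1; rewrite ler_piMl ?(ltW s1)// mulr_ge0 ?(ltW t0).
Qed.

Lemma exists_small_radius (R : realType) (L eps : R) (q : nat -> R) : 2 <= L ->
  (forall k, 0 < q k) -> (forall k, q k = L * q k.+1) -> 0 < eps ->
  exists N, q N <= eps.
Proof.
move=> L2 q0 qL eps0.
have q2 k : q k * 2 ^+ k <= q 0%N.
  elim: k => [|k]; first by rewrite expr0 mulr1.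
  apply: le_trans; rewrite (qL k) exprS mulrCA mulrA.
  rewrite ler_pM2r ?exprn_gt0// mulrC [leRHS]mulrC.
  by rewrite ler_pM2l.
exists (Num.trunc (q 0%N / eps)).+1; set N := _.+1.
have h : q 0%N / eps < 2 ^+ N.
  apply: lt_trans (truncnS_gt _) _; rewrite -natrX ltr_nat; exact: ltn_expl.
rewrite -(ler_pM2r (exprn_gt0 N (ltr0Sn R 1))).
apply: le_trans (q2 N) _.
by move: h; rewrite ltr_pdivrMr// mulrC => /ltW.
Qed.

(* Without convergence the limit is the default point 0 of the extended reals. *)
Lemma lime_le_junk (R : realType) (F : R -> \bar R) (B : \bar R) : (0 <= B)%E ->
  (forall eps, 0 < eps -> (F eps <= B)%E) -> (lim (F @ 0^'+) <= B)%E.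
Proof.
move=> B0 FB; have [cF|ncF] := pselect (cvg (F @ 0^'+)).
  apply: lime_le => //; near=> eps; apply: FB; near: eps; exact: nbhs_right_gt.
rewrite /lim /lim_in xgetPN// => l Fl; apply: ncF; exact: cvgP Fl.
Unshelve. all: by end_near. Qed.

Section main_bound.
Context {R : realType} {n : nat}.
Local Notation d := n.+1.

(** The absolute value keeps the constants positive for every real [ratio], as they are fixed before
    [E]. *)
Definition aspect_bound (ratio : R) : R := 4 * (`|ratio| + 1).
Definition scale_step (ratio : R) : R := 5 * aspect_bound ratio + 5.

Lemma pointed_body_ofP (E : set 'rV[R]_d) (ratio : R) x :
  bounded_set E ->
  (forall y z t, E y -> E z -> 0 <= t <= 1 -> E ((1 - t) *: y + t *: z)) ->
  interior E !=set0 -> supporting_normals E ->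
  outer_radius E / inner_radius E = ratio -> (frontier E) x ->
  exists rho x0, rho <= 2 * diam E /\
    pointed_body E x x0 (exterior_normal E x) rho (aspect_bound ratio).
Proof.
move=> bE cE intE nu rat Fx.
have [rho [x0 [rho0 x0E rhoD EM]]] := inner_outer_balls bE intE rat.
exists rho, x0; split => //; constructor => //.
- exact: Fx.1.
- by move=> y Ey; apply: EM => //; exact: Fx.1.
- by have [] := nu x Fx.
- by have [] := nu x Fx.
- by move=> y Fy; have [v1 vE] := nu y Fy; exists (exterior_normal E y).
Qed.

(** The number [N] of shells grows as [eps] decreases, but the bound [key] is the same for all [N]
    and so passes to the limit. *)
Lemma curvature_le_integral (ratio Cs : R) s (E : set 'rV[R]_d) x x0 rho (J : R) :
  let L := scale_step ratio in
  let c1 := line_constant R n / (8 * L ^+ (n + 4)) in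
  let c2 := line_constant R n / (2 ^+ n * (8 * aspect_bound ratio ^+ (n + 4))) in
  0 < Cs ->
  (forall x e (r t : R), enorm e = 1 -> 0 < r -> 0 <= t ->
    (@lebesgue_outer R d (slab x e r t) <= (Cs * t * r ^+ n)%:E)%E) ->
  0 < s < 1 -> supporting_normals E -> (frontier E) x ->
  pointed_body E x x0 (exterior_normal E x) rho (aspect_bound ratio) ->
  (\int[hausdorff R n d]_(y in frontier E) (frontier_integrand s E x y)%:E = J%:E)%E ->
  (fractional_mean_curvature s E x <=
    ((Cs * L ^+ (n + 2) * Num.sqrt (2 / c1) + 4 ^+ d * 10 * Num.sqrt c2^-1) *
     Num.sqrt ((1 - s) * (J * rho `^ (1 - s))))%:E)%E.
Proof.
move=> L c1 c2 Cs0 slabC s01 nu Fx B JE; have /andP[s0 s1] := s01.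
have [cE _ rho0 _ _ e1 _ _] := B.
have M1 : 1 <= aspect_bound ratio.
  by rewrite /aspect_bound; have := normr_ge0 ratio; lra.
have L2 : 2 <= L by rewrite /L /scale_step; lra.
have L0 : 0 < L by lra.
(* The largest initial scale allowed by the condition [5 * q 0 <= rho] of the boundary estimate. *)
pose q k := rho / 5 * L^-1 ^+ k.
have q0 k : 0 < q k by rewrite mulr_gt0 ?exprn_gt0 ?invr_gt0// divr_gt0.
have qL k : q k = L * q k.+1 by rewrite /q exprS; field; rewrite gt_eqF.
have q0rho : q 0%N = rho / 5 by rewrite /q expr0 mulr1.
have a0 := line_constant_gt0 R n.
have c10 : 0 < c1 by apply: (divr_gt0 a0); rewrite mulr_gt0 ?exprn_gt0.
have M0 : 0 < aspect_bound ratio by lra.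
have c20 : 0 < c2 by apply: (divr_gt0 a0); rewrite !mulr_gt0 ?exprn_gt0.
have rs0 : 0 < rho `^ s by rewrite powR_gt0.
pose G := (rho `^ s)^-1.
have G0 : 0 < G by rewrite invr_gt0.
have PE : rho `^ (1 - s) = G * rho.
  rewrite powRD ?(gt_eqF rho0) ?implybT// powRr1 ?(ltW rho0)// powRN mulrC //.
have J2 : c2 * (G / rho) <= J.
  by rewrite -lee_fin -JE; exact: (frontier_integral_far s01 M1 nu Fx B).
set KZ := (_ * _)%R.
have ss0 : 0 < s * (1 - s) by rewrite mulr_gt0// subr_gt0.
have C10 : 0 <= Cs * L ^+ (n + 2) by rewrite mulr_ge0 ?exprn_ge0 ?(ltW Cs0) ?(ltW L0).
have C20 : 0 <= 4 ^+ d * 10 :> R by rewrite mulr_ge0 ?exprn_ge0.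
have KZ0 : 0 <= KZ.
  apply: mulr_ge0; last exact: sqrtr_ge0.
  by apply: addr_ge0; (apply: mulr_ge0; last exact: sqrtr_ge0).
have key N : s * (1 - s) * (Cs * L ^+ (n + 2) *
     (\sum_(k < N) depth E x (exterior_normal E x) (q k) / q k * (q k `^ s)^-1) +
     4 ^+ d * (2 / s) * (q 0%N `^ s)^-1) <= KZ.
  set S := \sum_(k < N) _.
  pose A := \sum_(k < N) (depth E x (exterior_normal E x) (q k) / q k) ^+ 2 *
       (q k `^ s)^-1 / q k.
  pose W := \sum_(k < N) (q k `^ s)^-1 * q k.
  have g0 k : 0 < (q k `^ s)^-1 by rewrite invr_gt0 powR_gt0.
  have S0 : 0 <= S.
    apply: sumr_ge0 => k _; rewrite mulr_ge0 ?(ltW (g0 k))// divr_ge0 ?(ltW (q0 k))//.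
    exact: depth_ge0.
  have A0 : 0 <= A.
    apply: sumr_ge0 => k _; rewrite divr_ge0 ?(ltW (q0 k))//.
    by rewrite mulr_ge0 ?(ltW (g0 k))// sqr_ge0.
  have W0 : 0 <= W.
    by apply: sumr_ge0 => k _; rewrite mulr_ge0 ?(ltW (g0 k)) ?(ltW (q0 k)).
  have SAW : S ^+ 2 <= A * W.
    exact: (weighted_cauchy_schwarz (fun k : 'I_N =>
      depth E x (exterior_normal E x) (q k) / q k) (fun k => g0 k) (fun k => q0 k)).
  have J1 : c1 * A <= J.
    rewrite -lee_fin -JE; apply: (frontier_integral_near _ s01 M1 _ q0 qL _ nu Fx B) => //.
    by rewrite q0rho mulrC divfK.
  have WP : W <= 2 / (1 - s) * rho `^ (1 - s).
    apply: (sum_weights_le N s01 L2 q0 qL); rewrite q0rho ler_pdivrMr//.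
    by rewrite ler_peMr ?(ltW rho0)// ler1n.
  apply: le_trans (curvature_real_bound s01 C10 C20 c10 c20 rho0 S0 (ltW G0) SAW A0 W0 J1 WP J2 PE).
  rewrite ler_pM2l// lerD2l.
  (* The constant 10 is [2 * 5]: since [q 0 = rho / 5], its power [-s] is
     [5^s rho^-s <= 5 rho^-s]. *)
  have -> : 4 ^+ d * 10 * (G / s) = 4 ^+ d * (2 / s) * (5 * G) by field; rewrite gt_eqF.
  apply: ler_wpM2l; first by rewrite mulr_ge0 ?exprn_ge0// divr_ge0// ltW.
  have qs0 : 0 < q 0%N `^ s by rewrite powR_gt0.
  rewrite /G ler_pdivlMr// ler_pdivrMl//.
  have rhoE : rho = 5 * q 0%N by rewrite q0rho mulrC divfK.
  rewrite [in leLHS]rhoE powRM ?(ltW (q0 0%N))// mulrC ler_pM2l//.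
  by have := @ler_powR R 5 (ler1n _ 5) _ _ (ltW s1); rewrite powRr1.
rewrite /fractional_mean_curvature.
apply: (@le_trans _ _ ((s * (1 - s))%:E * (KZ / (s * (1 - s)))%:E)%E); last first.
  by rewrite -EFinM lee_fin mulrC divfK// gt_eqF.
apply: lee_wpmul2l; first by rewrite lee_fin ltW.
apply: lime_le_junk => [|eps eps0]; first by rewrite lee_fin divr_ge0// ltW.
have [N qN] := exists_small_radius L2 q0 qL eps0.
have L1 : 1 <= L by lra.
apply: le_trans (curvature_integral_bound s01 (ltW Cs0) slabC cE Fx.2 e1 L1 q0 qL eps0 qN) _.
by rewrite lee_fin ler_pdivlMr// mulrC; exact: key.
Qed.

End main_bound.

(* The ambient dimension is n.+1, so that the boundary has dimension n. *)
Theorem proposition4p2 (R : realType) (n : nat) (ratio : R) :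
  exists2 C : R, 0 < C &
  forall (s alpha : R) (E : set 'rV[R]_n.+1),
    0 < s < 1 -> s < alpha < 1 ->
    bounded_set E -> convex_set (E : set (convex_lmodType 'rV[R]_n.+1)) ->
    interior E !=set0 ->
    C1_holder_boundary alpha E ->
    outer_radius E / inner_radius E = ratio ->
    forall x : 'rV[R]_n.+1, frontier E x ->
    (fractional_mean_curvature s E x <=
      C%:E * (diam E `^ ((1 - s) / 2))%:E *
      ((1 - s)%:E *
        \int[hausdorff R n n.+1]_(y in frontier E)
          ((1 - dot (exterior_normal E y) (exterior_normal E x)) /
             enorm (x - y) `^ (n.+1%:R + s))%:E) `^ 2^-1)%E.
Proof.
have [Cs Cs0 slabC] := @slab_volume R n.
pose L := scale_step ratio.
pose c1 := line_constant R n / (8 * L ^+ (n + 4)).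
pose c2 := line_constant R n / (2 ^+ n * (8 * aspect_bound ratio ^+ (n + 4))).
pose K := Cs * L ^+ (n + 2) * Num.sqrt (2 / c1) + 4 ^+ n.+1 * 10 * Num.sqrt c2^-1.
have a0 := line_constant_gt0 R n.
have M0 : 0 < aspect_bound ratio by rewrite /aspect_bound; have := normr_ge0 ratio; lra.
have L0 : 0 < L by rewrite /L /scale_step; lra.
have c10 : 0 < c1 by apply: (divr_gt0 a0); rewrite mulr_gt0 ?exprn_gt0.
have c20 : 0 < c2 by apply: (divr_gt0 a0); rewrite !mulr_gt0 ?exprn_gt0.
have K0 : 0 < K.
  by rewrite /K addr_gt0// !mulr_gt0 ?exprn_gt0// sqrtr_gt0 ?invr_gt0// divr_gt0.
have C0 : 0 < K * Num.sqrt 2 by rewrite mulr_gt0// sqrtr_gt0.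
exists (K * Num.sqrt 2) => // s alpha E s01 _ bE convE intE holE rat x Fx.
have cE := convex_setP convE.
have nu : supporting_normals E by move=> y Fy; exact: exterior_normal_support holE Fy.
have [rho [x0 [rhoD B]]] := pointed_body_ofP bE cE intE nu rat Fx.
have rho0 := body_radius_gt0 B.
have /andP[s0 s1] := s01.
have t0 : 0 < 1 - s by lra.
have D0 : 0 < diam E by lra.
have Dp : 0 < diam E `^ ((1 - s) / 2) by rewrite powR_gt0.
have I0 : (0 <= \int[hausdorff R n n.+1]_(y in frontier E) (frontier_integrand s E x y)%:E)%E.
  by apply: integral_ge0 => y Fy; rewrite lee_fin; exact: frontier_integrand_ge0.
have bound J := @curvature_le_integral R n ratio Cs s E x x0 rho J Cs0 slabC s01 nu Fx B.
rewrite -[X in ((1 - s)%:E * X)%E]/(\int[hausdorff R n n.+1]_(y in frontier E)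
  (frontier_integrand s E x y)%:E)%E.
(* An infinite integral makes the right-hand side infinite, the diameter being positive; [I0]
   excludes [-oo]. *)
move: I0 bound; case: (integral _ _ _) => [J| |]// I0 bound; last first.
  by rewrite gt0_muley ?lte_fin// poweRyr ?invr_eq0// -EFinM gt0_muley ?lte_fin ?mulr_gt0// leey.
apply: le_trans (bound J erefl) _.
rewrite -/K -!EFinM lee_fin.
rewrite lee_fin in I0.
rewrite powR12_sqrt ?mulr_ge0 ?(ltW t0)// powRrM powR12_sqrt ?powR_ge0//.
rewrite -!mulrA ler_pM2l// -!sqrtrM ?mulr_ge0 ?powR_ge0//.
apply: ler_wsqrtr.
(* From [rho <= 2 diam E]; this is the origin of the factor [Num.sqrt 2] in the constant. *)
have P2 : rho `^ (1 - s) <= 2 * diam E `^ (1 - s).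
  apply: (@le_trans _ _ ((2 * diam E) `^ (1 - s))).
    by apply: (ge0_ler_powR (ltW t0)) => //; rewrite nnegrE ?mulr_ge0 ?(ltW rho0) ?(ltW D0).
  rewrite powRM ?(ltW D0)// ler_pM2r ?powR_gt0//.
  have := @ler_powR R 2 (ler1n _ 2) (1 - s) 1; rewrite powRr1//; apply; lra.
have -> : 2 * (diam E `^ (1 - s) * ((1 - s) * J)) =
    (1 - s) * (J * (2 * diam E `^ (1 - s))) by ring.
by rewrite ler_pM2l// ler_wpM2l.
Qed.
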